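(* Let $0<a<b<\infty$, let $x_1<\cdots<x_n$ be real numbers in $[a,b]$, let $\underline{s}=(s_1,\ldots,s_n)^T\in\mathbb{C}^{n}$, and let $P_n$ be the $n\times n$ Pick matrix with entries \[ (P_n)_{jk}=\frac{s_j+s_k}{x_j+x_k},\qquad 1\le j,k\le n. \] Then, for all integers $j\ge 1$ and $k\ge 0$ with $1\le j+2k\le n$, \[ \sigma_{j+2k}(P_n)\le 4\left[\exp\left(\frac{\pi^2}{2\mu(a/b)}\right)\right]^{-2k}\sigma_j(P_n), \] where $\mu$ is the Gr\''otzsch ring function. The bound remains valid if $\mu(a/b)$ is replaced by $\log(4b/a)$.
   Context: $\sigma_1(P)\ge\cdots\ge\sigma_n(P)\ge 0$ denote the singular values of an $n\times n$ matrix $P$. The Gr\''otzsch ring function is $\mu(\lambda)=\frac{\pi}{2}\,K(\sqrt{1-\lambda^2})/K(\lambda)$ for $0<\lambda<1$, where $K(\lambda)=\int_0^1 \frac{dt}{\sqrt{(1-t^2)(1-\lambda^2t^2)}}$ is the complete elliptic integral of the first kind. *)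

(* Defs.v *)
From mathcomp Require Import all_boot all_order all_algebra.
From mathcomp Require Import spectral sesquilinear.
From mathcomp Require Import complex.
From mathcomp Require Import all_classical all_reals all_analysis.

Set Implicit Arguments.
Unset Strict Implicit.
Unset Printing Implicit Defensive.

Import Order.TTheory GRing.Theory Num.Theory.

Local Open Scope ring_scope.
Local Open Scope classical_set_scope.
Local Open Scope complex_scope.
Local Open Scope sesquilinear_scope.

(* P^t* *m P is Hermitian, hence normal, so that its spectral_diag lists its
   eigenvalues with multiplicity (in no particular order). They are real and
   nonnegative elements of R[i]. *)
Definition singular_values (R : realType) (n : nat) (P : 'M[R[i]]_n) : seq R :=
  sort (fun u v : R => v <= u)
    [seq Num.sqrt (complex.Re (spectral_diag (P^t* *m P) 0 i)) | i : 'I_n].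

(* The index k is 1-based: sigma P 1 is the largest singular value, and
   sigma P k is meaningful for 1 <= k <= n. *)
Definition sigma (R : realType) (n : nat) (P : 'M[R[i]]_n) (k : nat) : R :=
  nth 0 (singular_values P) k.-1.

(* For 0 < l < 1 the integrand is singular at t = 1 only, where division by 0
   gives it the value 0; it is integrable on [0, 1]. *)
Definition ellipticK (R : realType) (l : R) : R :=
  \int[@lebesgue_measure R]_(t in `[0, 1])
    (Num.sqrt ((1 - t ^+ 2) * (1 - l ^+ 2 * t ^+ 2)))^-1.

Definition grotzsch_mu (R : realType) (l : R) : R :=
  pi / 2 * (ellipticK (Num.sqrt (1 - l ^+ 2)) / ellipticK l).

Definition pick_mx (R : realType) (n : nat) (x : 'I_n -> R)
    (s : 'cV[R[i]]_n) : 'M[R[i]]_n :=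
  \matrix_(j < n, k < n) ((s j 0 + s k 0) / (x j + x k)%:C).

(* Main.v *)
Require Import Defs.
From mathcomp Require Import all_boot all_order all_algebra.
From mathcomp Require Import spectral sesquilinear.
From mathcomp Require Import complex.
From mathcomp Require Import all_classical all_reals all_analysis.
From mathcomp Require Import measurable_realfun.
From mathcomp Require Import ring lra zify.

(** The Pick matrix P satisfies X P + P X = s 1^T + 1 s^T with X = diag x, a
    matrix of rank at most 2.  If D is the diagonal matrix of the values at the
    x_i of a product r of k factors (y - t) / (y + t) with t > 0, telescoping
    over the factors shows that P - D P D has rank at most 2 k
    ([rank_blaschke]).  A Courant-Fischer argument then gives
    sigma_{j+2k} <= (max |r|)^2 sigma_j ([sigma_compression]).  It remains to
    choose the nodes t so that |r| <= 2 exp (- k nu) on [a, b], where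
    nu = pi^2 / (2 mu (a / b)); after scaling, [a, b] is [l, 1] with l = a / b.

    These nodes are Zolotarev's: the segment [l, 1] is parametrised by the
    Jacobi function dn, and the nodes are equally spaced in the parameter.  By
    the addition theorem, ((dn u - dn v) / (dn u + dn v))^2 is a product of a
    function of u - v and the same function of u + v ([dn_ratio]).  Hence the
    square of the product z_N of degree N is periodic in the parameter, which
    makes its level sets explicit ([zol_pencil]).  Two facts follow.  The maximum
    e_N of |z_N| on [l, 1] is its value at 1 ([zol_bound]), and
    e_N^2 (1 + e_{2N}^2) = 2 e_{2N} ([zol_double]).

    The constant 2 and the rate come out together, without theta functions.  The
    quadratic map t -> (t + l / t) / (1 + l) folds [l, 1] onto [l', 1], with
    l' = 2 sqrt l / (1 + l), and carries the product of degree 2N for l to the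
    product of degree N for l' ([zol_landen]), while Landen's transformation of
    elliptic integrals gives nu (l') = 2 nu (l) ([rate_landen]).  So the quantity
    A (l) = (e_N (l) / 2) exp (N nu (l)) satisfies A (l)^2 <= A (l').  A crude bound
    on A, uniform in l, applied along the orbit of l, forces A (l) <= 1
    ([zol_le_rate]).  The same device, run along the inverse map, proves
    mu (l) <= ln (4 / l) ([grotzsch_mu_le_ln]), whence the second estimate. *)

Set Implicit Arguments.
Unset Strict Implicit.
Unset Printing Implicit Defensive.

Import Order.TTheory GRing.Theory Num.Theory.
Import numFieldTopology.Exports numFieldNormedType.Exports.

Local Open Scope ring_scope.

(** * Singular values under a low-rank perturbation *)

Definition blaschke (F : fieldType) (t : seq F) (x : F) : F :=
  \prod_(u <- t) ((x - u) / (x + u)).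

Section Sigma.
Local Open Scope complex_scope.
Local Open Scope sesquilinear_scope.
Variable R : realType.
Local Notation C := R[i].

Definition sqnorm n (w : 'rV[C]_n) : C := \sum_i `|w 0 i| ^+ 2.

Lemma sqnormE n (w : 'rV[C]_n) : sqnorm w = (w *m w^t*) 0 0.
Proof. by rewrite mxE; apply: eq_bigr => i _; rewrite !mxE normCK. Qed.

Lemma sqnorm_row m n (W : 'M[C]_(m, n)) i : sqnorm (row i W) = (W *m W^t*) i i.
Proof. by rewrite mxE; apply: eq_bigr => k _; rewrite !mxE normCK. Qed.

Lemma sqnorm_ge0 n (w : 'rV[C]_n) : 0 <= sqnorm w.
Proof. by apply: sumr_ge0 => i _; rewrite exprn_ge0. Qed.

Lemma sqnorm_gt0 n (w : 'rV[C]_n) : w != 0 -> 0 < sqnorm w.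
Proof.
move=> w0; rewrite lt_neqAle sqnorm_ge0 andbT eq_sym.
apply: contra_neq w0 => /eqP; rewrite psumr_eq0 => [|i _]; last exact: exprn_ge0.
move=> /allP h; apply/rowP => i; rewrite mxE.
by have := h i (mem_index_enum i); rewrite /= sqrf_eq0 normr_eq0 => /eqP.
Qed.

Lemma sqnorm_unitary n (w : 'rV[C]_n) (U : 'M[C]_n) :
  U \is unitarymx -> sqnorm (w *m U^t*) = sqnorm w.
Proof.
move=> UU; rewrite !sqnormE trmx_mul map_mxM trmxCK mulmxA.
by rewrite -[_ *m _ *m U]mulmxA -invmx_unitary // mulVmx ?unitarymx_unit // mulmx1.
Qed.

Definition gram n (P : 'M[C]_n) : 'M[C]_n := P^t* *m P.

Lemma gramtC n (P : 'M[C]_n) : (gram P)^t* = gram P.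
Proof. by rewrite /gram trmx_mul map_mxM trmxCK. Qed.

Definition sing_val n (P : 'M[C]_n) (i : 'I_n) : R :=
  Num.sqrt (complex.Re (spectral_diag (gram P) 0 i)).

Lemma gram_spectral n (P : 'M[C]_n) (U := spectralmx (gram P)) :
  gram P = U^t* *m diag_mx (spectral_diag (gram P)) *m U.
Proof.
rewrite -invmx_unitary ?spectral_unitarymx //; apply/orthomx_spectralP.
by apply/normalmxP; rewrite gramtC.
Qed.

(** The i-th eigenvalue is the squared norm of the i-th row of U P^t*, where U
    is the diagonalising unitary matrix.  It is therefore a nonnegative real, and
    nothing is lost in taking the square root of its real part. *)
Lemma spectral_diag_gram n (P : 'M[C]_n) i :
  spectral_diag (gram P) 0 i = ((sing_val P i) ^+ 2)%:C.
Proof.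
set d := spectral_diag _.
have dE : d 0 i = sqnorm (row i (spectralmx (gram P) *m P^t*)).
  have /unitarymxP UU := spectral_unitarymx (gram P).
  have : spectralmx (gram P) *m gram P *m (spectralmx (gram P))^t* = diag_mx d.
    by rewrite {2}gram_spectral !mulmxA UU mul1mx -mulmxA UU mulmx1.
  move/matrixP => /(_ i i); rewrite [RHS]mxE eqxx mulr1n => <-.
  by rewrite sqnorm_row trmx_mul map_mxM trmxCK !mulmxA.
have : 0 <= d 0 i by rewrite dE sqnorm_ge0.
rewrite /sing_val -/d; case: (d 0 i) => a b; rewrite lecE /= => /andP[/eqP -> a0].
by rewrite sqr_sqrtr.
Qed.

(** Row vectors are used throughout, so that P acts through its adjoint.  In
    the spectral coordinates of the Gram matrix the squared norm is diagonal. *)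
Lemma sqnorm_gram n (P : 'M[C]_n) (w : 'rV[C]_n) :
  sqnorm (w *m P^t*) =
  \sum_i ((sing_val P i) ^+ 2)%:C * `|(w *m (spectralmx (gram P))^t*) 0 i| ^+ 2.
Proof.
rewrite sqnormE trmx_mul map_mxM trmxCK.
rewrite mulmxA -(mulmxA w) -/(gram P) [in LHS]gram_spectral !mulmxA.
set U := spectralmx _; set c := w *m U^t*.
have -> : c *m diag_mx (spectral_diag (gram P)) *m U *m w^t* =
          c *m diag_mx (spectral_diag (gram P)) *m c^t*.
  by rewrite /c trmx_mul map_mxM trmxCK !mulmxA.
clearbody c; rewrite mxE; apply: eq_bigr => i _.
by rewrite mul_mx_diag !mxE spectral_diag_gram normCK mulrAC mulrC.
Qed.

Let geR : rel R := fun u v => v <= u.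

Let geR_total : total geR.
Proof. by move=> u v; exact: le_total. Qed.

Let geR_trans : transitive geR.
Proof. by move=> u v w vu uw; exact: le_trans uw vu. Qed.

Let geR_refl : reflexive geR.
Proof. by move=> u; exact: lexx. Qed.

Lemma count_ge_sorted (t : seq R) m : (m < size t)%N ->
  (m < count (fun u => nth 0 (sort geR t) m <= u)%R t)%N.
Proof.
move=> mt; set s := sort geR t.
have st : size s = size t by rewrite size_sort.
have ss : sorted geR s by exact: sort_sorted.
have /permP <- : perm_eq s t by rewrite perm_sort.
rewrite -{2}(cat_take_drop m.+1 s) count_cat (leq_trans _ (leq_addr _ _)) //.
suff : all (fun u => nth 0 s m <= u)%R (take m.+1 s).
  by rewrite all_count size_takel ?st // => /eqP ->.
apply/(all_nthP 0) => i; rewrite size_takel ?st // => im; rewrite nth_take //.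
apply: (sorted_leq_nth geR_trans geR_refl 0 ss); rewrite ?inE ?st //.
by rewrite (leq_ltn_trans _ mt).
Qed.

Lemma count_gt_sorted (t : seq R) m : (m < size t)%N ->
  (count (fun u => nth 0 (sort geR t) m < u)%R t <= m)%N.
Proof.
move=> mt; set s := sort geR t.
have st : size s = size t by rewrite size_sort.
have ss : sorted geR s by exact: sort_sorted.
have /permP <- : perm_eq s t by rewrite perm_sort.
rewrite -{2}(cat_take_drop m s) count_cat.
have -> : count (fun u => (nth 0 s m < u)%R) (drop m s) = 0%N.
  apply/eqP; rewrite -leqn0 leqNgt -has_count; apply/negP => /(has_nthP 0)[k].
  rewrite size_drop st nth_drop => im; rewrite ltNge => /negP; apply.
  apply: (sorted_leq_nth geR_trans geR_refl 0 ss); rewrite ?inE ?st //.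
    by rewrite -ltn_subRL.
  exact: leq_addr.
by rewrite addn0 (leq_trans (count_size _ _)) // size_takel // st ltnW.
Qed.

(** This count and the next one are all that is needed of the ordering of the
    singular values: they are the dimensions of the spectral subspaces on which P is
    bounded below by its m-th singular value, or stretches by more than it. *)
Lemma card_sing_val_ge n (P : 'M[C]_n) m : (1 <= m <= n)%N ->
  (m <= #|[set i | (sigma P m <= sing_val P i)%R]|)%N.
Proof.
case: m => // m /= mn.
have := @count_ge_sorted [seq sing_val P i | i : 'I_n] m.
rewrite size_map -cardE card_ord => /(_ mn).
by rewrite count_map cardsE cardE enumT /enum_mem size_filter.
Qed.

Lemma card_sing_val_gt n (P : 'M[C]_n) m : (1 <= m <= n)%N ->
  (#|[set i | (sigma P m < sing_val P i)%R]| < m)%N.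
Proof.
case: m => // m /= mn.
have := @count_gt_sorted [seq sing_val P i | i : 'I_n] m.
rewrite size_map -cardE card_ord => /(_ mn).
by rewrite count_map cardsE cardE enumT /enum_mem size_filter ltnS.
Qed.

Lemma sigma_ge0 n (P : 'M[C]_n) m : 0 <= sigma P m.
Proof.
rewrite /sigma /singular_values; set s := sort _ _.
have [ms|ms] := ltnP m.-1 (size s); last by rewrite nth_default.
have := mem_nth 0 ms; move: (nth 0 s m.-1) => u.
by rewrite mem_sort => /mapP[k _ ->]; exact: sqrtr_ge0.
Qed.

(** Encodes the vanishing of the coordinates in A as #|A| linear equations
    w *m mask_mx A = 0. *)
Definition mask_mx n (A : {set 'I_n}) : 'M[C]_n :=
  diag_mx (\row_i (i \in A)%:R).

Lemma rank_mask_mx n (A : {set 'I_n}) : (\rank (mask_mx A) <= #|A|)%N.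
Proof.
pose B : 'M[C]_(n, #|A|) := \matrix_(i, j) (i == enum_val j)%:R.
have -> : mask_mx A = B *m B^T.
  apply/matrixP => i k; rewrite !mxE.
  under eq_bigr do rewrite !mxE -natrM mulnb.
  have [<-|ik] := eqVneq i k; last first.
    rewrite mulr0n big1 // => j _.
    case: (i =P enum_val j) => [ij|//]; case: (k =P enum_val j) => [kj|//].
    by rewrite ij kj eqxx in ik.
  rewrite mulr1n; have [iA|iA] := boolP (i \in A).
    rewrite (bigD1 (enum_rank_in iA i)) //= enum_rankK_in // eqxx big1 ?addr0 //.
    move=> j; case: (i =P enum_val j) => [ij|//] /eqP; case.
    by apply: enum_val_inj; rewrite enum_rankK_in.
  rewrite big1 // => j _; case: (i =P enum_val j) => [ij|//].
  by rewrite ij enum_valP in iA.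
exact: leq_trans (mxrankM_maxl _ _) (rank_leq_col _).
Qed.

Lemma mxrank_row_mx (F : fieldType) m n1 n2 (A : 'M[F]_(m, n1)) (B : 'M[F]_(m, n2)) :
  (\rank (row_mx A B) <= \rank A + \rank B)%N.
Proof.
by rewrite -mxrank_tr tr_row_mx -addsmxE -(mxrank_tr A) -(mxrank_tr B) mxrank_adds_leqif.
Qed.

Lemma mask_mx_eq0 n (A : {set 'I_n}) (w : 'rV[C]_n) :
  w *m mask_mx A = 0 -> forall i, i \in A -> w 0 i = 0.
Proof.
by move=> /rowP h k kA; have := h k; rewrite mul_mx_diag !mxE kA mulr1.
Qed.

Lemma sqnorm_diag_le n (f : 'I_n -> R) (e : R) (w : 'rV[C]_n) :
  (forall i, `|f i| <= e) ->
  sqnorm (w *m diag_mx (\row_i (f i)%:C)) <= (e ^+ 2)%:C * sqnorm w.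
Proof.
move=> fe; rewrite /sqnorm mulr_sumr; apply: ler_sum => i _.
rewrite mul_mx_diag !mxE normrM exprMn mulrC ler_wpM2r ?exprn_ge0 //.
rewrite -add_Re2_Im2 /= expr0n /= addr0 lecR -real_normK ?num_real //.
by rewrite lerXn2r ?nnegrE // (le_trans _ (fe i)).
Qed.

(** Three conditions are imposed on a vector w: it lies in the span of the
    first j + r singular directions of P, D w is orthogonal to the first j - 1 of
    them, and P and D P D agree on w.  A nonzero solution exists by counting
    dimensions, and on it |P w| = |D P D w| <= e sigma_j |D w| <= e^2 sigma_j |w|. *)
Theorem sigma_compression n (P : 'M[C]_n) (f : 'I_n -> R) (e : R) (r j : nat)
    (D := diag_mx (\row_i (f i)%:C)) :
  (forall i, `|f i| <= e) -> (\rank (P - D *m P *m D)%R <= r)%N ->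
  (1 <= j)%N -> (j + r <= n)%N ->
  sigma P (j + r) <= e ^+ 2 * sigma P j.
Proof.
move=> fe rk j1 jrn; set U := spectralmx (gram P).
have e0 : 0 <= e.
  have n0 : (0 < n)%N by lia.
  exact: le_trans (fe (Ordinal n0)).
set A := [set i | (sigma P (j + r) <= sing_val P i)%R].
set B := [set i | (sigma P j < sing_val P i)%R].
have cA : (j + r <= #|A|)%N by rewrite card_sing_val_ge //; lia.
have cB : (#|B| < j)%N by rewrite card_sing_val_gt //; lia.
pose X := U^t* *m mask_mx (~: A).
pose Y := D *m U^t* *m mask_mx B.
pose Z := (P - D *m P *m D)^t*.
have rX : (\rank X <= n - (j + r))%N.
  rewrite (leq_trans (mxrankM_maxr _ _)) // (leq_trans (rank_mask_mx _)) //.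
  by rewrite cardsCs finset.setCK card_ord leq_sub2l.
have rY : (\rank Y <= j.-1)%N.
  rewrite (leq_trans (mxrankM_maxr _ _)) // (leq_trans (rank_mask_mx _)) //.
  by rewrite -ltnS prednK.
have rZ : (\rank Z <= r)%N by rewrite /Z mxrank_map mxrank_tr.
(* The ranks add up to (n - j - r) + (j - 1) + r = n - 1. *)
have rM : (\rank (row_mx (row_mx X Y) Z) < n)%N.
  apply: leq_ltn_trans (mxrank_row_mx _ _) _.
  apply: leq_ltn_trans (leq_add (leq_trans (mxrank_row_mx _ _) (leq_add rX rY)) rZ) _.
  by clear -j1 jrn; lia.
have : kermx (row_mx (row_mx X Y) Z) != 0.
  by rewrite -mxrank_eq0 mxrank_ker -lt0n subn_gt0.
case/rowV0Pn => w /sub_kermxP; rewrite !mul_mx_row => /eqP.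
rewrite -!row_mx0 => /eqP/eq_row_mx[/eq_row_mx[wX wY] wZ] w0.
have wP : w *m P^t* = w *m D *m P^t* *m D.
  have DtC : D^t* = D.
    rewrite /D tr_diag_mx map_diag_mx; congr diag_mx; apply/rowP => i.
    by rewrite !mxE; apply: conj_Creal; apply/complex_realP; exists (f i).
  move: wZ; rewrite /Z linearB /= map_mxB mulmxBr => /eqP.
  rewrite subr_eq0 => /eqP ->.
  by rewrite !trmx_mul !map_mxM DtC !mulmxA.
have lo : ((sigma P (j + r)) ^+ 2)%:C * sqnorm w <= sqnorm (w *m P^t*).
  rewrite sqnorm_gram -(@sqnorm_unitary _ w U) ?spectral_unitarymx //.
  rewrite /sqnorm mulr_sumr; apply: ler_sum => i _.
  have [iA|iA] := boolP (i \in A).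
    rewrite ler_wpM2r ?exprn_ge0 // lecR lerXn2r ?nnegrE ?sigma_ge0 ?sqrtr_ge0 //.
    by move: iA; rewrite inE.
  move: wX; rewrite /X mulmxA => /mask_mx_eq0/(_ i) ->; last by rewrite inE.
  by rewrite normr0 expr0n /= !mulr0.
have hi : sqnorm (w *m D *m P^t*) <= ((sigma P j) ^+ 2)%:C * sqnorm (w *m D).
  rewrite sqnorm_gram -(@sqnorm_unitary _ (w *m D) U) ?spectral_unitarymx //.
  rewrite /sqnorm mulr_sumr; apply: ler_sum => i _.
  have [iB|iB] := boolP (i \in B).
    move: wY; rewrite /Y !mulmxA => /mask_mx_eq0/(_ i iB) ->.
    by rewrite normr0 expr0n /= !mulr0.
  rewrite ler_wpM2r ?exprn_ge0 // lecR lerXn2r ?nnegrE ?sigma_ge0 ?sqrtr_ge0 //.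
  by move: iB; rewrite inE -leNgt.
have : ((sigma P (j + r)) ^+ 2)%:C * sqnorm w
    <= ((e ^+ 2 * sigma P j) ^+ 2)%:C * sqnorm w.
  apply: (le_trans lo); rewrite wP.
  apply: (le_trans (sqnorm_diag_le _ fe)).
  have c0 (x : R) : 0 <= (x ^+ 2)%:C :> C by rewrite lecR sqr_ge0.
  apply: (le_trans (ler_wpM2l (c0 _) hi)).
  apply: (le_trans (ler_wpM2l (c0 _) (ler_wpM2l (c0 _) (sqnorm_diag_le _ fe)))).
  rewrite !mulrA -!rmorphM /= ler_wpM2r ?sqnorm_ge0 // lecR.
  by rewrite le_eqVlt; apply/orP; left; apply/eqP; ring.
rewrite ler_pM2r ?sqnorm_gt0 // lecR ler_pXn2r // nnegrE ?sigma_ge0 //.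
by rewrite mulr_ge0 ?sigma_ge0 ?sqr_ge0.
Qed.

(** * Displacement structure of Pick matrices *)

(** The denominator of the entry (i, k) is exactly what the left-hand side
    multiplies it by, which leaves s 1^T + 1 s^T. *)
Lemma pick_displacement n (x : 'I_n -> R) (s : 'cV[C]_n)
    (X := diag_mx (\row_i (x i)%:C)) :
  (forall i, 0 < x i) ->
  (\rank (X *m pick_mx x s + pick_mx x s *m X)%R <= 2)%N.
Proof.
move=> x0.
have -> : X *m pick_mx x s + pick_mx x s *m X =
    s *m const_mx 1 + const_mx 1 *m s^T.
  apply/matrixP => i k; rewrite mul_diag_mx mul_mx_diag !mxE !big_ord1 !mxE.
  rewrite mulrC -mulrDr -rmorphD /= mulr1 mul1r divfK //.
  by rewrite fmorph_eq0 gt_eqF // addr_gt0.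
rewrite (leq_trans (mxrank_add _ _)) // -[2%N]/(1 + 1)%N leq_add //.
  exact: leq_trans (mxrankM_maxl _ _) (rank_leq_col _).
exact: leq_trans (mxrankM_maxl _ _) (rank_leq_col _).
Qed.

(** For one factor, P - E P E = 2 u V (X P + P X) V with V = (X + u)^-1, of rank
    at most 2.  For a product, P - (D E) P (D E) = (P - E P E) + E (P - D P D) E. *)
Lemma rank_blaschke n (x : 'I_n -> R) (s : 'cV[C]_n) (t : seq R) :
  (forall i, 0 < x i) -> (forall u, u \in t -> 0 < u) ->
  let D := diag_mx (\row_i (blaschke t (x i))%:C) in
  (\rank (pick_mx x s - D *m pick_mx x s *m D)%R <= 2 * size t)%N.
Proof.
move=> x0; set P := pick_mx x s; elim: t => [|u t IH] t0 /=.
  have -> : diag_mx (\row_i (blaschke [::] (x i))%:C) = 1%:M.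
    by rewrite -diag_const_mx; congr diag_mx; apply/rowP => i; rewrite !mxE /blaschke big_nil.
  by rewrite mul1mx mulmx1 subrr mxrank0.
have u0 : 0 < u by apply: t0; rewrite mem_head.
have {}IH := IH (fun v vt => t0 v (mem_behead (s := u :: t) vt)).
set D := diag_mx (\row_i (blaschke t (x i))%:C) in IH.
pose E : 'M[C]_n := diag_mx (\row_i ((x i - u) / (x i + u))%:C).
pose V : 'M[C]_n := diag_mx (\row_i ((x i + u)^-1)%:C).
pose X : 'M[C]_n := diag_mx (\row_i (x i)%:C).
have xu i : x i + u != 0 by rewrite gt_eqF // addr_gt0.
have -> : diag_mx (\row_i (blaschke (u :: t) (x i))%:C) = D *m E.
  rewrite mulmx_diag; congr diag_mx; apply/rowP => i.
  by rewrite !mxE /blaschke big_cons rmorphM mulrC.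
have -> : D *m E *m P *m (D *m E) = E *m (D *m P *m D) *m E.
  have DE : D *m E = E *m D by exact: diag_mxC.
  by rewrite {1}DE !mulmxA.
have PE : P - E *m P *m E = (2 * u)%:C *: (V *m (X *m P + P *m X) *m V).
  apply/matrixP => i k; rewrite /E /V /X !(mul_diag_mx, mul_mx_diag) !mxE.
  move: ((s i 0 + s k 0) / _) => p.
  have xu' k' : (x k')%:C + u%:C != 0 by rewrite -rmorphD fmorph_eq0.
  by rewrite !(rmorphM, fmorphV, rmorphB, rmorphD) /=; field; rewrite !xu'.
have -> : P - E *m (D *m P *m D) *m E =
    (2 * u)%:C *: (V *m (X *m P + P *m X) *m V) + E *m (P - D *m P *m D) *m E.
  by rewrite mulmxBr mulmxBl -PE addrA subrK.
rewrite (leq_trans (mxrank_add _ _)) // mulnS leq_add //.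
  rewrite (leq_trans (mxrankS (scalemx_sub _ (submx_refl _)))) //.
  rewrite (leq_trans (mxrankM_maxl _ _)) // (leq_trans (mxrankM_maxr _ _)) //.
  exact: pick_displacement.
by rewrite (leq_trans (mxrankM_maxl _ _)) // (leq_trans (mxrankM_maxr _ _)).
Qed.

End Sigma.

(** * Primitives of continuous functions *)

Section Primitive.
Local Open Scope classical_set_scope.
Variable R : realType.
Implicit Types (f F : R -> R).
Local Notation mu := (@lebesgue_measure R).

Lemma derive_continuous F f : (forall x : R, is_derive x 1 F (f x)) -> continuous F.
Proof.
by move=> dF x; apply/differentiable_continuous/derivable1_diffP; case: (dF x).
Qed.

Lemma derive_mvt F f a b : a <= b ->
  (forall x : R, a <= x <= b -> is_derive x 1 F (f x)) ->
  exists2 c, a <= c <= b & F b - F a = f c * (b - a).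
Proof.
move=> ab dF.
have [|x|c + cE] := @MVT_segment R F f a b ab.
- by move=> x; rewrite in_itv /= => /andP[ax xb]; apply: dF; rewrite !ltW.
- apply: derivable_within_continuous => {}x; rewrite in_itv /= => xab.
  by case: (dF x xab).
by rewrite in_itv /=; exists c.
Qed.

(** The base point moves with x so that one formula serves both signs of x. *)
Definition primitive f x : R :=
  (\int[mu]_(t in `](- (`|x| + 1))%R, x]) f t) -
  (\int[mu]_(t in `](- (`|x| + 1))%R, 0]) f t).

(** Near a given point the base point may be fixed, by additivity of the
    integral; then the fundamental theorem of calculus applies. *)
Lemma is_derive_primitive f (x : R) : continuous f -> is_derive x 1 (primitive f) (f x).
Proof.
move=> cf; pose A := `|x| + 2.
have intf a b : mu.-integrable `]a, b] (EFin \o f).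
  apply: (@integrableS _ _ _ mu `[a, b]) => //.
    by apply: subset_itvr; rewrite bnd_simp.
  apply: continuous_compact_integrable; first exact: segment_compact.
  exact: continuous_subspaceT.
pose G (y : R) : R := \int[mu]_(t in `](- A)%R, y]) f t.
have xx1 : x < x + 1 by rewrite ltrDl.
have Ax : (BRight (- A) < BRight x)%O.
  by rewrite bnd_simp /A; have := ler_norm (- x); rewrite normrN; lra.
have dG : is_derive x 1 G (f x).
  have [dG GE] := continuous_FTC1 xx1 (intf (- A) (x + 1)) Ax (cf x).
  by split => //; rewrite -GE derive1E.
have dH : is_derive x 1 (fun y => G y - G 0) (f x).
  rewrite -[f x]subr0; exact: is_deriveB.
apply: near_eq_is_derive dH; rewrite ?oner_neq0 //.
near=> y.
have yx : `|x - y| < 1 by near: y; exact: (@nbhsx_ballx _ _ x 1).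
have yA : `|y| + 1 <= A.
  rewrite /A; have := ler_normB x (x - y); have -> : x - (x - y) = y by ring.
  lra.
have y0 : 0 <= `|y| by [].
have ny : - `|y| <= y by rewrite lerNl -normrN ler_norm.
rewrite /primitive.
rewrite -(@Rintegral_itvB R f (BRight (- A)) (BRight y) (- (`|y| + 1))) //; last 2 first.
  by rewrite bnd_simp; lra.
  by rewrite bnd_simp; lra.
rewrite -(@Rintegral_itvB R f (BRight (- A)) (BRight 0) (- (`|y| + 1))) //; last 2 first.
  by rewrite bnd_simp; lra.
  by rewrite bnd_simp; lra.
by rewrite /G; ring.
Unshelve. all: by end_near. Qed.

Lemma primitive0 f : primitive f 0 = 0.
Proof. by rewrite /primitive subrr. Qed.

End Primitive.

(** * Jacobi elliptic functions of a real argument *)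

Section Jacobi.
Local Open Scope classical_set_scope.
Variable R : realType.

Definition delta (l p : R) : R := Num.sqrt (cos p ^+ 2 + l ^+ 2 * sin p ^+ 2).

(** The incomplete elliptic integral of the first kind for the modulus
    complementary to l.  With this convention dn takes its values in [l, 1]. *)
Definition ellF (l : R) : R -> R := primitive (fun p => (delta l p)^-1).

Definition am (l u : R) : R := xget 0 [set p | ellF l p = u].

Definition sn (l u : R) : R := sin (am l u).
Definition cn (l u : R) : R := cos (am l u).
Definition dn (l u : R) : R := delta l (am l u).

(** The complete elliptic integral for the modulus complementary to l. *)
Definition ellI (l : R) : R := ellF l (pi / 2).

Variable l : R.
Hypotheses (l_gt0 : 0 < l) (l_lt1 : l < 1).

Let m := 1 - l ^+ 2.

Lemma m_gt0 : 0 < m.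
Proof. by rewrite subr_gt0 expr_lt1 // ltW. Qed.

Lemma delta_radicand p : cos p ^+ 2 + l ^+ 2 * sin p ^+ 2 = 1 - m * sin p ^+ 2.
Proof. by rewrite cos2sin2 /m; ring. Qed.

Lemma delta_radicand_ge p : l ^+ 2 <= cos p ^+ 2 + l ^+ 2 * sin p ^+ 2.
Proof.
have := mulr_ge0 (sqr_ge0 (cos p)) (ltW m_gt0).
by rewrite /m sin2cos2; nra.
Qed.

Lemma sqr_delta p : delta l p ^+ 2 = 1 - m * sin p ^+ 2.
Proof.
rewrite sqr_sqrtr ?delta_radicand // -delta_radicand.
by rewrite (le_trans _ (delta_radicand_ge p)) ?sqr_ge0.
Qed.

Lemma delta_ge p : l <= delta l p.
Proof.
rewrite -{1}(ger0_norm (ltW l_gt0)) -sqrtr_sqr; apply: ler_wsqrtr.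
exact: delta_radicand_ge.
Qed.

Lemma delta_gt0 p : 0 < delta l p.
Proof. exact: lt_le_trans (delta_ge p). Qed.

Lemma delta_le1 p : delta l p <= 1.
Proof.
have := mulr_ge0 (ltW m_gt0) (sqr_ge0 (sin p)).
by have := sqr_delta p; have := delta_gt0 p; nra.
Qed.

Lemma is_derive_delta (p : R) :
  is_derive p 1 (delta l) (- m * sin p * cos p / delta l p).
Proof.
have r0 : 0 < cos p ^+ 2 + l ^+ 2 * sin p ^+ 2.
  by rewrite (lt_le_trans _ (delta_radicand_ge p)) // exprn_gt0.
have e : delta l = Num.sqrt \o (fun p : R => cos p ^+ 2 + l ^+ 2 *: sin p ^+ 2).
  by apply/funext.
rewrite e; apply: is_derive_eq.
  apply: is_derive1_comp; exact: (is_derive1_sqrt r0).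
rewrite /= /GRing.scale /= -/(delta l p) /m.
by field; rewrite gt_eqF ?delta_gt0.
Qed.

Lemma continuous_delta : continuous (delta l).
Proof. exact: derive_continuous is_derive_delta. Qed.

Lemma is_derive_ellF (p : R) : is_derive p 1 (ellF l) (delta l p)^-1.
Proof.
apply: is_derive_primitive => {}p.
apply: continuousV; first by rewrite gt_eqF ?delta_gt0.
exact: continuous_delta.
Qed.

Lemma ellF0 : ellF l 0 = 0. Proof. exact: primitive0. Qed.

Lemma continuous_ellF : continuous (ellF l).
Proof. exact: derive_continuous is_derive_ellF. Qed.

(** The integrand is at least 1; this makes ellF l an increasing bijection of
    the line, whose inverse is the amplitude. *)
Lemma ellFB_ge p q : p <= q -> q - p <= ellF l q - ellF l p.
Proof.
move=> pq; have [c _ ->] := derive_mvt pq (fun x _ => is_derive_ellF x).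
rewrite -[leLHS]mul1r ler_wpM2r ?subr_ge0 //.
by rewrite invf_ge1 ?delta_le1 ?delta_gt0.
Qed.

Lemma ler_ellF : {mono ellF l : p q / p <= q}.
Proof. by apply: le_mono => p q pq; have := ellFB_ge (ltW pq); lra. Qed.

Lemma ltr_ellF : {mono ellF l : p q / p < q}.
Proof. exact: leW_mono ler_ellF. Qed.

Lemma ellF_inj : injective (ellF l).
Proof. exact: inc_inj ler_ellF. Qed.

Lemma ellFN p : ellF l (- p) = - ellF l p.
Proof.
pose G q := ellF l q + ellF l (- q).
suff : G p = G 0 by rewrite /G oppr0 ellF0; lra.
apply: is_derive_0_is_cst => q.
have dN : is_derive q 1 (ellF l \o -%R) ((delta l (- q))^-1 * -1).
  by apply: is_derive1_comp; exact: is_derive_ellF.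
have := @is_deriveD _ _ _ _ _ _ _ _ _ (is_derive_ellF q) dN.
by rewrite /delta sinN cosN sqrrN mulrN1 subrr.
Qed.

Lemma ellF_surj u : exists p, ellF l p = u.
Proof.
have u0 : 0 <= `|u| by [].
have [|||p _ <-] := @IVT R (ellF l) (- `|u|) `|u| u.
- lra.
- exact/continuous_subspaceT/continuous_ellF.
- have h1 := ellFB_ge u0; rewrite ellF0 in h1.
  rewrite ellFN ge_min le_max.
  have := ler_norm u; have := ler_norm (- u); rewrite normrN => h2 h3.
  by apply/andP; split; apply/orP; [left|right]; lra.
by exists p.
Qed.

Lemma amK : cancel (am l) (ellF l).
Proof. by move=> u; rewrite /am; case: xgetP => // h; have [p /h] := ellF_surj u. Qed.

Lemma ellFK : cancel (ellF l) (am l).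
Proof. by move=> p; apply: ellF_inj; rewrite amK. Qed.

Lemma is_derive_am (u : R) : is_derive u 1 (am l) (dn l u).
Proof.
rewrite -{1}(amK u) -[dn l u]invrK.
apply: is_derive_inverse.
- by near=> p; exact: ellFK.
- by near=> p; exact: continuous_ellF.
- exact: is_derive_ellF.
- by rewrite invr_neq0 // gt_eqF // delta_gt0.
Unshelve. all: by end_near. Qed.

Lemma is_derive_sn (u : R) : is_derive u 1 (sn l) (cn l u * dn l u).
Proof. by apply: is_derive1_comp; exact: is_derive_am. Qed.

Lemma is_derive_cn (u : R) : is_derive u 1 (cn l) (- (sn l u * dn l u)).
Proof. by rewrite -mulNr; apply: is_derive1_comp; exact: is_derive_am. Qed.

Lemma dn_gt0 u : 0 < dn l u. Proof. exact: delta_gt0. Qed.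
Lemma dn_ge u : l <= dn l u. Proof. exact: delta_ge. Qed.
Lemma dn_le1 u : dn l u <= 1. Proof. exact: delta_le1. Qed.

Lemma is_derive_dn (u : R) : is_derive u 1 (dn l) (- m * sn l u * cn l u).
Proof.
have -> : - m * sn l u * cn l u = - m * sn l u * cn l u / dn l u * dn l u.
  by rewrite divfK // gt_eqF ?dn_gt0.
by apply: is_derive1_comp; [exact: is_derive_delta | exact: is_derive_am].
Qed.

Lemma sqr_cn u : cn l u ^+ 2 = 1 - sn l u ^+ 2. Proof. exact: cos2sin2. Qed.
Lemma sqr_dn u : dn l u ^+ 2 = 1 - m * sn l u ^+ 2. Proof. exact: sqr_delta. Qed.

Lemma am0 : am l 0 = 0. Proof. by rewrite -{1}ellF0 ellFK. Qed.
Lemma sn0 : sn l 0 = 0. Proof. by rewrite /sn am0 sin0. Qed.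
Lemma cn0 : cn l 0 = 1. Proof. by rewrite /cn am0 cos0. Qed.
Lemma dn0 : dn l 0 = 1.
Proof. by rewrite /dn am0 /delta sin0 cos0 expr1n expr0n mulr0 addr0 sqrtr1. Qed.

Lemma amN u : am l (- u) = - am l u.
Proof. by apply: ellF_inj; rewrite ellFN !amK. Qed.
Lemma snN u : sn l (- u) = - sn l u. Proof. by rewrite /sn amN sinN. Qed.
Lemma cnN u : cn l (- u) = cn l u. Proof. by rewrite /cn amN cosN. Qed.
Lemma dnN u : dn l (- u) = dn l u.
Proof. by rewrite /dn amN /delta sinN cosN sqrrN. Qed.

Lemma add_denom_gt0 u v : 0 < 1 - m * sn l u ^+ 2 * sn l v ^+ 2.
Proof.
have := sqr_cn u; have := sqr_cn v.
have := sqr_ge0 (cn l u); have := sqr_ge0 (cn l v).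
have := sqr_ge0 (sn l u); have := sqr_ge0 (sn l v).
have : 0 < l ^+ 2 by rewrite exprn_gt0.
have : 0 < m by rewrite subr_gt0 expr_lt1 // ltW.
rewrite /m; set a := sn l u ^+ 2; set b := sn l v ^+ 2.
move: (cn l u ^+ 2) (cn l v ^+ 2) => c d.
move: a b (l ^+ 2) => a b k; intros.
have : a * b <= 1 by nra.
nra.
Qed.

(** On the line of all pairs of sum w = u + v, the right-hand side is a
    function of u with zero derivative, and it is equal to dn w at u = 0. *)
Lemma dnD u v : dn l (u + v) =
  (dn l u * dn l v - m * sn l u * sn l v * cn l u * cn l v) /
  (1 - m * sn l u ^+ 2 * sn l v ^+ 2).
Proof.
pose w := u + v.
pose S x := sn l (w - x); pose C x := cn l (w - x); pose D x := dn l (w - x).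
pose P x := dn l x * D x - m *: (sn l x * S x * (cn l x * C x)).
pose Q x := 1 - m *: (sn l x ^+ 2 * S x ^+ 2).
have dw (x : R) : is_derive x 1 (fun x => w - x) (-1).
  by rewrite -sub0r; apply: is_deriveB.
have dS (x : R) : is_derive x 1 S (- (C x * D x)).
  by rewrite -mulrN1; apply: is_derive1_comp; exact: is_derive_sn.
have dC (x : R) : is_derive x 1 C (S x * D x).
  by rewrite -[_ * _]opprK -mulrN1; apply: is_derive1_comp; exact: is_derive_cn.
have dD (x : R) : is_derive x 1 D (m * S x * C x).
  have -> : m * S x * C x = (- m * S x * C x) * -1 by ring.
  by apply: is_derive1_comp; exact: is_derive_dn.
have Q0 x : Q x != 0.
  by rewrite gt_eqF // /Q /GRing.scale /= mulrA; exact: add_denom_gt0.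
(* Derivatives of the numerator P and the denominator Q, simplified by the
   quadratic relations between sn, cn and dn. *)
pose dP x := 2 * m * sn l x * S x * (sn l x * C x * dn l x - S x * cn l x * D x).
pose dQ x := 2 * m * sn l x * S x * (sn l x * C x * D x - cn l x * dn l x * S x).
have isdP (x : R) : is_derive x 1 P (dP x).
  have ds := is_derive_sn x; have dc := is_derive_cn x; have dd := is_derive_dn x.
  have dS' := dS x; have dC' := dC x; have dD' := dD x.
  apply: is_derive_eq; rewrite /dP /GRing.scale /=.
  have := sqr_cn (w - x); have := sqr_cn x; rewrite -/(C x) -/(S x).
  move: (S x) (C x) (D x) (sn l x) (cn l x) (dn l x) => s2 c2 d2 s1 c1 d1 e1 e2.
  ring: e1 e2.
have isdQ (x : R) : is_derive x 1 Q (dQ x).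
  have ds := is_derive_sn x; have dS' := dS x.
  by apply: is_derive_eq; rewrite /dQ /GRing.scale /=; ring.
have dN (x : R) : is_derive x 1 (fun x => P x * (Q x)^-1) 0.
  have dV := is_deriveV (Q0 x) (isdQ x).
  have dP' := isdP x; apply: is_derive_eq; rewrite /GRing.scale /=.
  suff -> : dP x = P x * dQ x / Q x by field; exact: Q0.
  apply: (canRL (mulfK (Q0 x))); rewrite /P /dP /Q /dQ /GRing.scale /=.
  have := sqr_cn (w - x); have := sqr_dn (w - x); have := sqr_cn x; have := sqr_dn x.
  rewrite -/(S x) -/(C x) -/(D x).
  move: (S x) (C x) (D x) (sn l x) (cn l x) (dn l x) => s2 c2 d2 s1 c1 d1 e1 e2 e3 e4.
  ring: e1 e2 e3 e4.
have := is_derive_0_is_cst 0 u dN.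
rewrite /P /Q /S /C /D /w /GRing.scale /= subr0 sn0 cn0 dn0 (addrC u v) addrK => e.
rewrite -[LHS]divr1 -[LHS]mulr1.
have -> : dn l (v + u) / 1 * 1 =
    (1 * dn l (v + u) - m * (0 * sn l (v + u) * (1 * cn l (v + u)))) /
    (1 - m * (0 ^+ 2 * sn l (v + u) ^+ 2)).
  by rewrite expr0n /= !(mul0r, mulr0) !subr0 mul1r !divr1 mulr1.
by rewrite e !mulrA.
Qed.

(** Up to a constant factor and a change of modulus, the square of
    Jacobi's sn. *)
Definition dn_cayley u := (1 - dn l u) / (1 + dn l u).

(** Expanding dn (u - v) and dn (u + v) by the addition theorem turns this
    into a polynomial identity in the values of sn, cn, dn at u and v. *)
Lemma dn_ratio u v :
  ((dn l u - dn l v) / (dn l u + dn l v)) ^+ 2 =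
  dn_cayley (u - v) * dn_cayley (u + v).
Proof.
have := add_denom_gt0 u v; have := dn_gt0 u; have := dn_gt0 v.
have := dn_gt0 (u - v); have := dn_gt0 (u + v).
rewrite /dn_cayley !dnD snN cnN dnN.
have := sqr_cn u; have := sqr_dn u; have := sqr_cn v; have := sqr_dn v.
rewrite !sqrrN.
move: (sn l u) (cn l u) (dn l u) (sn l v) (cn l v) (dn l v).
move=> s1 c1 d1 s2 c2 d2 e1 e2 e3 e4 p1 p2 d20 d10 q0.
have q0' : 1 - m * s1 ^+ 2 * s2 ^+ 2 != 0 by rewrite gt_eqF.
set Q := 1 - _ in q0 q0' p1 p2 *.
set A := d1 * d2 - m * s1 * s2 * c1 * c2 in p1 *.
have -> : d1 * d2 - m * s1 * - s2 * c1 * c2 = d1 * d2 + m * s1 * s2 * c1 * c2 by ring.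
have {}p2 : 0 < (d1 * d2 + m * s1 * s2 * c1 * c2) / Q.
  by move: p2; congr (0 < _ / Q); ring.
set B := d1 * d2 + _ in p2 *.
have A0 : 0 < A by move: p1; rewrite pmulr_lgt0 // invr_gt0.
have B0 : 0 < B by move: p2; rewrite pmulr_lgt0 // invr_gt0.
have h : (Q - B) * (Q - A) * (d1 + d2) ^+ 2 = (Q + B) * (Q + A) * (d1 - d2) ^+ 2.
  have AB : A + B = 2 * d1 * d2 by rewrite /A /B; ring.
  have ABQ : Q ^+ 2 + A * B = Q * (d1 ^+ 2 + d2 ^+ 2).
    by rewrite /A /B /Q; ring: e1 e2 e3 e4.
  have -> : (Q - B) * (Q - A) = (Q ^+ 2 + A * B) - Q * (A + B) by ring.
  have -> : (Q + B) * (Q + A) = (Q ^+ 2 + A * B) + Q * (A + B) by ring.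
  by rewrite AB ABQ; ring.
have n1 : d1 + d2 != 0 by rewrite gt_eqF // addr_gt0.
have n2 : Q + A != 0 by rewrite gt_eqF // addr_gt0.
have n3 : Q + B != 0 by rewrite gt_eqF // addr_gt0.
transitivity ((Q - B) / (Q + B) * ((Q - A) / (Q + A))); last by field; rewrite ?n2 ?n3 ?q0'.
apply/eqP; rewrite expr_div_n mulf_div eqr_div ?mulf_neq0 ?expf_neq0 //.
by rewrite h mulrC.
Qed.

Let K := ellI l.

Lemma ellI_gt0 : 0 < K.
Proof. by rewrite -ellF0 ltr_ellF divr_gt0 ?pi_gt0. Qed.

Lemma amK_ellI : am l K = pi / 2. Proof. exact: ellFK. Qed.

Lemma dn_ellI : dn l K = l.
Proof.
rewrite /dn amK_ellI /delta sin_pihalf cos_pihalf expr0n expr1n add0r mulr1.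
by rewrite sqrtr_sqr gtr0_norm.
Qed.

(** The shift by the quarter period is the involution x -> l / x of [l, 1]. *)
Lemma dnDK u : dn l (u + K) = l / dn l u.
Proof.
rewrite dnD dn_ellI /sn /cn amK_ellI sin_pihalf cos_pihalf !mulr0 subr0.
rewrite expr1n mulr1 -/(sn l u) -sqr_dn.
by field; rewrite gt_eqF // dn_gt0.
Qed.

Lemma dnD2K u : dn l (u + 2 * K) = dn l u.
Proof.
have -> : u + 2 * K = u + K + K by ring.
by rewrite !dnDK; field; rewrite !gt_eqF // dn_gt0.
Qed.

Lemma ltr_am : {mono am l : u v / u < v}.
Proof. by move=> u v; rewrite -ltr_ellF !amK. Qed.

Lemma dn_lt u v : 0 <= u -> u < v -> v <= K -> dn l v < dn l u.
Proof.
move=> u0 uv vK.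
have au0 : 0 <= am l u by rewrite -am0 leNgt ltr_am -leNgt.
have avK : am l v <= pi / 2 by rewrite -amK_ellI leNgt ltr_am -leNgt.
have auv : am l u < am l v by rewrite ltr_am.
have suv : sn l u < sn l v.
  have p0 : 0 < pi :> R := pi_gt0 R.
  have uI : am l u \in `[(- (pi / 2)), (pi / 2)]%R.
    by rewrite in_itv /=; apply/andP; split; lra.
  have vI : am l v \in `[(- (pi / 2)), (pi / 2)]%R.
    by rewrite in_itv /=; apply/andP; split; lra.
  by rewrite /sn (ltr_sin uI vI).
have su : 0 <= sn l u.
  have p0 : 0 < pi :> R := pi_gt0 R.
  rewrite /sn sin_ge0_pi //; apply/andP; split; lra.
have := sqr_dn u; have := sqr_dn v; have := dn_gt0 u; have := dn_gt0 v.
have : m * sn l u ^+ 2 < m * sn l v ^+ 2.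
  by rewrite ltr_pM2l ?m_gt0 // ltrXn2r // ?nnegrE // (le_trans su) // ltW.
by move=> h1 h2 h3 h4 h5; nra.
Qed.

Lemma dn_surj x : l <= x <= 1 -> exists2 u, 0 <= u <= K & dn l u = x.
Proof.
move=> /andP[lx x1]; pose y := Num.sqrt ((1 - x ^+ 2) / m).
have x0 : 0 < x by exact: lt_le_trans lx.
have y2 : y ^+ 2 = (1 - x ^+ 2) / m.
  by rewrite sqr_sqrtr // divr_ge0 ?(ltW m_gt0) // subr_ge0 expr_le1 // ltW.
have y0 : 0 <= y by exact: sqrtr_ge0.
have y1 : y <= 1.
  rewrite -(@ler_pXn2r _ 2) ?nnegrE // expr1n y2 ler_pdivrMr ?m_gt0 // mul1r /m.
  by rewrite lerB // ler_pXn2r // nnegrE ltW.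
have yI : y \in `[(-1), 1]%R by rewrite in_itv /=; apply/andP; split; lra.
have yI' : -1 <= y <= 1 by [].
exists (ellF l (asin y)).
  rewrite -{1}ellF0 /K /ellI !ler_ellF asin_lepi2 // andbT.
  rewrite leNgt; apply/negP => h.
  have p0 : 0 < pi :> R := pi_gt0 R.
  have aI : asin y \in `[(- (pi / 2)), (pi / 2)]%R.
    by rewrite in_itv /= asin_geNpi2 // asin_lepi2.
  have oI : (0 : R) \in `[(- (pi / 2)), (pi / 2)]%R.
    by rewrite in_itv /=; apply/andP; split; lra.
  by move: h; rewrite -(ltr_sin aI oI) asinK // sin0 ltNge y0.
rewrite /dn ellFK; apply/eqP; rewrite -(@eqrXn2 _ 2) //.
- by rewrite sqr_delta asinK // y2; apply/eqP; field; rewrite gt_eqF ?m_gt0.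
- exact/ltW/delta_gt0.
- exact/ltW.
Qed.
End Jacobi.

(** * Zolotarev products *)

(** The left-hand side is a polynomial in x of degree size rs with leading
    coefficient 1 - c, and rs lists all its roots. *)
Lemma pencil_factor (F : fieldType) (ts ts' rs : seq F) (c : F) :
  c != 1 -> size ts = size rs -> size ts' = size rs -> uniq rs ->
  (forall r, r \in rs ->
    \prod_(u <- ts) (r - u) = c * \prod_(u <- ts') (r - u)) ->
  forall x, \prod_(u <- ts) (x - u) - c * \prod_(u <- ts') (x - u) =
            (1 - c) * \prod_(r <- rs) (x - r).
Proof.
move=> c1 sz sz' urs hr x.
pose P (us : seq F) : {poly F} := \prod_(u <- us) ('X - u%:P).
have PE us y : (P us).[y] = \prod_(u <- us) (y - u).
  by rewrite horner_prod; apply: eq_bigr => u _; rewrite hornerXsubC.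
have Psz us : size (P us) = (size us).+1 by rewrite size_prod_XsubC.
have Plead us : (P us)`_(size us) = 1.
  have /monicP := monic_prod_XsubC us xpredT id.
  by rewrite lead_coefE -/(P us) Psz.
pose q := P ts - c *: P ts'.
have qn : q`_(size rs) = 1 - c.
  by rewrite coefB coefZ -{1}sz Plead -sz' Plead mulr1.
have szq : size q = (size rs).+1.
  apply/eqP; rewrite eqn_leq; apply/andP; split.
    rewrite (leq_trans (size_polyD _ _)) // size_polyN geq_max Psz sz leqnn /=.
    by rewrite (leq_trans (size_scale_leq _ _)) // Psz sz'.
  rewrite ltnNge; apply/negP => /leq_sizeP/(_ _ (leqnn _)).
  by rewrite qn => /eqP; rewrite subr_eq0 eq_sym (negPf c1).
have : q = (1 - c) *: P rs.
  have <- : lead_coef q = 1 - c by rewrite lead_coefE szq.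
  apply: all_roots_prod_XsubC => //.
    by apply/allP => r rr; rewrite rootE /q !hornerE !PE hr // subrr.
  by rewrite uniq_rootsE.
by move/(congr1 (fun p => p.[x])); rewrite /q !hornerE !PE.
Qed.

Section Zolotarev.
Variables (R : realType) (l : R).
Hypotheses (l_gt0 : 0 < l) (l_lt1 : l < 1).

Local Notation K := (ellI l).

(** Half of the distance, in the parameter u, between consecutive nodes. *)
Definition zol_step (N : nat) : R := K / (2 * N)%:R.

Definition zol_nodes (N : nat) : seq R :=
  [seq dn l ((2 * i + 1)%:R * zol_step N) | i <- index_iota 0 N].

Definition zol (N : nat) : R -> R := blaschke (zol_nodes N).

Lemma zolE N x : zol N x = \prod_(0 <= i < N)
  ((x - dn l ((2 * i + 1)%:R * zol_step N)) / (x + dn l ((2 * i + 1)%:R * zol_step N))).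
Proof. by rewrite /zol /blaschke big_map. Qed.

Lemma zol_step_gt0 N : (0 < N)%N -> 0 < zol_step N.
Proof. by move=> N0; rewrite divr_gt0 ?ellI_gt0 // ltr0n muln_gt0. Qed.

Lemma zol_stepK N : (0 < N)%N -> (2 * N)%:R * zol_step N = K.
Proof. by move=> N0; rewrite mulrC divfK // pnatr_eq0 muln_eq0 -lt0n. Qed.

Lemma zol_step2 N : zol_step N = 2 * zol_step (2 * N).
Proof.
rewrite /zol_step; case: N => [|N]; first by rewrite !muln0 invr0 !mulr0.
have : N.+1%:R != 0 :> R by rewrite pnatr_eq0.
by rewrite !natrM; move: (N.+1%:R) => n n0; field.
Qed.

Lemma zol_nodesP N t : t \in zol_nodes N -> l <= t <= 1.
Proof. by case/mapP => i _ ->; rewrite dn_ge ?dn_le1. Qed.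

Lemma zol_nodes_lt1 N t : t \in zol_nodes N -> t < 1.
Proof.
case/mapP => i; rewrite mem_index_iota /= => iN ->.
have N0 : (0 < N)%N by lia.
rewrite -[X in _ < X](dn0 l_gt0 l_lt1); apply: dn_lt => //.
  by rewrite mulr_gt0 ?zol_step_gt0 // ltr0n addn1.
rewrite -(zol_stepK N0) ler_wpM2r ?(ltW (zol_step_gt0 N0)) // ler_nat; lia.
Qed.

Lemma dn_cayleyD2K u : dn_cayley l (u + 2 * K) = dn_cayley l u.
Proof. by rewrite /dn_cayley dnD2K. Qed.

(** By dn_ratio, the node of parameter v contributes the shifts by v and by
    - v; modulo the period 2 K these are all the odd multiples of the step. *)
Lemma sqr_zol N u : (0 < N)%N -> zol N (dn l u) ^+ 2 =
  \prod_(0 <= i < 2 * N) dn_cayley l (u + (2 * i + 1)%:R * zol_step N).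
Proof.
move=> N0; rewrite zolE -prodrXl.
under eq_bigr do rewrite dn_ratio //.
rewrite big_split /= mulrC.
have -> : (2 * N = N + N)%N by lia.
rewrite [RHS](big_cat_nat (n := N)) ?leq_addr //=.
congr (_ * _); rewrite [RHS]big_nat_rev /=.
(* The upper half of the range, read backwards, gives the negative shifts. *)
have shiftN (G : nat -> R) : \prod_(N <= i < N + N) G i = \prod_(0 <= i < N) G (i + N)%N.
  by rewrite -{1}[N]add0n big_addn addnK.
rewrite shiftN; apply: eq_big_nat => i /andP[_ iN].
rewrite -dn_cayleyD2K; congr dn_cayley.
rewrite -(zol_stepK N0) -addrA; congr (_ + _).
have -> : (2 * (N + (N + N) - (i + N).+1) + 1)%:R = 2 * (2 * N)%:R - (2 * i + 1)%:R :> R.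
  apply/eqP; rewrite eq_sym subr_eq -natrM -natrD; apply/eqP; congr (_%:R); lia.
ring.
Qed.

(** The shift permutes the factors of sqr_zol cyclically. *)
Lemma sqr_zol_shift N u : (0 < N)%N ->
  zol N (dn l (u + 2 * zol_step N)) ^+ 2 = zol N (dn l u) ^+ 2.
Proof.
move=> N0; rewrite !sqr_zol //.
pose F i := dn_cayley l (u + (2 * i + 1)%:R * zol_step N).
transitivity (\prod_(0 <= i < 2 * N) F i.+1).
  apply: eq_bigr => i _; congr dn_cayley.
  by rewrite -addrA -mulrDl -natrD; congr (_ + _%:R * _); lia.
have [M eM] : exists M, (2 * N = M.+1)%N by exists (2 * N).-1; lia.
rewrite eM [RHS]big_nat_recl // [LHS]big_nat_recr //= mulrC; congr (_ * _).
rewrite /F -[RHS]dn_cayleyD2K; congr dn_cayley.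
rewrite -(zol_stepK N0) -addrA; congr (_ + _).
have -> : (2 * N)%:R = M%:R + 1 :> R by rewrite eM -natr1.
by rewrite muln0 add0n natrD natrM; ring.
Qed.

Lemma sqr_zol_shiftn N n u : (0 < N)%N ->
  zol N (dn l (u + (2 * n)%:R * zol_step N)) ^+ 2 = zol N (dn l u) ^+ 2.
Proof.
move=> N0; elim: n => [|n IH]; first by rewrite muln0 mul0r addr0.
rewrite -IH -[RHS]sqr_zol_shift //; congr (zol N (dn l _) ^+ 2).
by rewrite mulnS (natrD _ 2); ring.
Qed.

Lemma zol_node N : (0 < N)%N -> zol N (dn l (zol_step N)) = 0.
Proof.
case: N => // N _; rewrite zolE big_nat_recl // muln0 add0n mul1r subrr.
by rewrite !mul0r.
Qed.

Lemma zol_gt0 N : 0 < zol N 1.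
Proof.
rewrite /zol /blaschke big_seq; apply: prodr_gt0 => t tN.
have := zol_nodes_lt1 tN; have /andP[] := zol_nodesP tN => h1 h2 h3.
rewrite divr_gt0 ?subr_gt0 // addr_gt0 //; exact: lt_le_trans h1.
Qed.

(** Crude, but balanced against expR_rate_le uniformly in l. *)
Lemma zol_le N : zol N 1 <= (1 - l) ^+ N.
Proof.
have -> : (1 - l) ^+ N = \prod_(0 <= i < N) (1 - l).
  by rewrite prodr_const_nat subn0.
rewrite zolE; apply: ler_prod => i _.
have := dn_ge l_gt0 l_lt1 ((2 * i + 1)%:R * zol_step N).
have := dn_le1 l_gt0 l_lt1 ((2 * i + 1)%:R * zol_step N).
move: (dn l _) l_gt0 l_lt1 => t l0 l1 t1 lt; apply/andP; split.
  by apply: divr_ge0; lra.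
by rewrite ler_pdivrMr; nra.
Qed.

Lemma sqr_zol_lt1 N x : (0 < N)%N -> 0 < x -> zol N x ^+ 2 < 1.
Proof.
move=> N0 x0; rewrite zolE -prodrXl.
case: N N0 => // N _; rewrite big_nat_recl //.
have h i : 0 <= ((x - dn l ((2 * i + 1)%:R * zol_step N.+1)) /
               (x + dn l ((2 * i + 1)%:R * zol_step N.+1))) ^+ 2 < 1.
  rewrite sqr_ge0 /=; have := dn_gt0 l_gt0 l_lt1 ((2 * i + 1)%:R * zol_step N.+1).
  move: (dn l _) => t t0; rewrite expr_div_n ltr_pdivrMr; nra.
have /andP[h0 h1] := h 0%N.
apply: le_lt_trans h1; rewrite ler_piMr //.
by apply: prodr_ile1 => i _; have /andP[-> /ltW] := h i.+1.
Qed.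
Lemma zol_num_den N x :
  zol N x = \prod_(t <- zol_nodes N) (x - t) / \prod_(t <- zol_nodes N) (x + t).
Proof. by rewrite /zol /blaschke -prodf_div. Qed.

Lemma zol_den_gt0 N x : 0 < x -> 0 < \prod_(t <- zol_nodes N) (x + t).
Proof.
move=> x0; rewrite big_seq; apply: prodr_gt0 => t /zol_nodesP/andP[lt _].
by rewrite addr_gt0 // (lt_le_trans l_gt0).
Qed.

(** The points where the square of the product takes the same value as at
    dn al, obtained from al by periodicity and parity. *)
Definition level_nodes N al : seq R :=
  [seq dn l ((2 * i)%:R * zol_step N + al) | i <- index_iota 0 N] ++
  [seq dn l ((2 * i.+1)%:R * zol_step N - al) | i <- index_iota 0 N].

(** The level points are 2 N distinct roots of a polynomial of degree 2 N. *)
Lemma zol_pencil N al : (0 < N)%N -> 0 < al < zol_step N ->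
  forall x, \prod_(t <- zol_nodes N) (x - t) ^+ 2 -
     zol N (dn l al) ^+ 2 * \prod_(t <- zol_nodes N) (x + t) ^+ 2 =
  (1 - zol N (dn l al) ^+ 2) * \prod_(r <- level_nodes N al) (x - r).
Proof.
move=> N0 /andP[al0 als]; have s0 := zol_step_gt0 N0.
pose ts := zol_nodes N ++ zol_nodes N.
pose ts' := [seq - t | t <- ts].
have szN : size (zol_nodes N) = N by rewrite size_map size_iota subn0.
have szr : size (level_nodes N al) = (N + N)%N.
  by rewrite size_cat !size_map size_iota subn0.
have P1 x : \prod_(u <- ts) (x - u) = \prod_(t <- zol_nodes N) (x - t) ^+ 2.
  by rewrite big_cat /= -big_split.
have P2 x : \prod_(u <- ts') (x - u) = \prod_(t <- zol_nodes N) (x + t) ^+ 2.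
  by rewrite big_map big_cat /= -big_split /=; apply: eq_bigr => t _; rewrite opprK.
have pts i : (i < N)%N ->
    (0 < (2 * i)%:R * zol_step N + al < K) /\
    (0 < (2 * i.+1)%:R * zol_step N - al < K).
  move=> iN; have e1 : (2 * i.+1)%:R = (2 * i)%:R + 2 :> R by rewrite -natrD; congr _%:R; lia.
  have h : (2 * i.+1)%:R * zol_step N <= K.
    rewrite -(zol_stepK N0) ler_wpM2r ?(ltW s0) // ler_nat; lia.
  have h0 : 0 <= (2 * i)%:R * zol_step N by rewrite mulr_ge0 // ltW.
  by move: h h0; rewrite e1 => h h0; split; apply/andP; split; nra.
have dn_inj u v : 0 < u < K -> 0 < v < K -> dn l u = dn l v -> u = v.
  move=> /andP[u0 uK] /andP[v0 vK] e; case: (ltgtP u v) => // uv.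
    by have := dn_lt l_gt0 l_lt1 (ltW u0) uv (ltW vK); rewrite e ltxx.
  by have := dn_lt l_gt0 l_lt1 (ltW v0) uv (ltW uK); rewrite e ltxx.
have natr_mul_inj i j : (2 * i)%:R * zol_step N = (2 * j)%:R * zol_step N -> i = j.
  move/(mulIf (lt0r_neq0 s0))/eqP; rewrite eqr_nat => /eqP; lia.
move=> x; rewrite -P1 -P2; apply: pencil_factor.
- by rewrite lt_eqF // sqr_zol_lt1 // dn_gt0.
- by rewrite szr size_cat szN.
- by rewrite szr size_map size_cat szN.
- rewrite cat_uniq; apply/and3P; split.
  + rewrite map_inj_in_uniq ?iota_uniq // => i j.
    rewrite !mem_index_iota /= => /pts[h1 _] /pts[h2 _] /(dn_inj _ _ h1 h2).
    by move/addIr/natr_mul_inj.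
  + apply/hasPn => _ /mapP[i + ->]; rewrite mem_index_iota /= => /pts[_ h1].
    apply/negP => /mapP[j]; rewrite mem_index_iota /= => /pts[h2 _].
    move=> /(dn_inj _ _ h1 h2) e.
    have {}e : ((2 * i.+1)%:R - (2 * j)%:R) * zol_step N = 2 * al by lra.
    have [ij|ij] := leqP i.+1 j.
      have : (2 * i.+1)%:R <= (2 * j)%:R :> R by rewrite ler_nat; lia.
      by nra.
    have : (2 * j)%:R + 2 <= (2 * i.+1)%:R :> R by rewrite -natrD ler_nat; lia.
    by nra.
  + rewrite map_inj_in_uniq ?iota_uniq // => i j.
    rewrite !mem_index_iota /= => /pts[_ h1] /pts[_ h2] /(dn_inj _ _ h1 h2).
    by move/addIr/natr_mul_inj => -[].
have key u : zol N (dn l u) ^+ 2 = zol N (dn l al) ^+ 2 ->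
    \prod_(t <- zol_nodes N) (dn l u - t) ^+ 2 =
    zol N (dn l al) ^+ 2 * \prod_(t <- zol_nodes N) (dn l u + t) ^+ 2.
  move=> <-; rewrite zol_num_den expr_div_n -!prodrXl divfK //.
  by rewrite prodrXl expf_neq0 // gt_eqF // zol_den_gt0 // dn_gt0.
move=> r; rewrite P1 P2 mem_cat => /orP[]/mapP[i _ ->]; apply: key.
  by rewrite addrC sqr_zol_shiftn.
by rewrite addrC sqr_zol_shiftn // dnN.
Qed.

(** At x = 1 the right-hand side of zol_pencil is positive, so the value at
    any parameter strictly between 0 and the step is below the value at 0.
    Periodicity and parity reduce every other parameter to this range. *)
Lemma sqr_zol_le N u : (0 < N)%N -> 0 <= u -> zol N (dn l u) ^+ 2 <= zol N 1 ^+ 2.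
Proof.
move=> N0; have s0 := zol_step_gt0 N0.
have small al : 0 <= al <= zol_step N -> zol N (dn l al) ^+ 2 <= zol N 1 ^+ 2.
  move=> /andP[]; rewrite le_eqVlt => /predU1P[<- _|al0]; first by rewrite dn0.
  rewrite le_eqVlt => /predU1P[->|als]; first by rewrite zol_node // expr0n sqr_ge0.
  have := zol_pencil N0 (introT andP (conj al0 als)) 1.
  set c := zol N _ ^+ 2.
  have c1 : c < 1 by rewrite sqr_zol_lt1 // dn_gt0.
  have : 0 <= \prod_(r <- level_nodes N al) (1 - r).
    rewrite big_seq; apply: prodr_ge0 => r.
    by rewrite mem_cat => /orP[]/mapP[i _ ->]; rewrite subr_ge0 dn_le1.
  have := zol_den_gt0 N ltr01; rewrite zol_num_den expr_div_n -!prodrXl => d0 p0 e.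
  rewrite ler_pdivlMr; last by rewrite prodrXl exprn_gt0.
  by rewrite -subr_ge0 e mulr_ge0 // subr_ge0 ltW.
have [n] : exists n, u < n%:R * (2 * zol_step N).
  exists (Num.bound `|u / (2 * zol_step N)|).
  have s2 : 0 < 2 * zol_step N by rewrite pmulr_rgt0.
  rewrite -ltr_pdivrMr //.
  exact: le_lt_trans (ler_norm _) (archi_boundP (normr_ge0 _)).
elim: n u => [|n IH] u un u0; first by move: un; rewrite mul0r ltNge u0.
have [us|us] := lerP u (zol_step N); first by apply: small; rewrite u0.
have [u2s|u2s] := lerP (2 * zol_step N) u.
  have -> : u = u - 2 * zol_step N + 2 * zol_step N by ring.
  rewrite sqr_zol_shift // IH //; last by lra.
  by move: un; rewrite -natr1; lra.
rewrite -dnN // -sqr_zol_shift //; apply: small; apply/andP; split; lra.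
Qed.

Lemma zol_bound N x : (0 < N)%N -> l <= x <= 1 -> `|zol N x| <= zol N 1.
Proof.
move=> N0 /(dn_surj l_gt0 l_lt1)[u /andP[u0 _] <-].
rewrite -(@ler_pXn2r _ 2) ?nnegrE ?(ltW (zol_gt0 N)) //.
by rewrite real_normK ?num_real // sqr_zol_le.
Qed.

Lemma big_nat_double (F : nat -> R) N :
  \prod_(0 <= i < 2 * N) F i =
  \prod_(0 <= i < N) F (2 * i)%N * \prod_(0 <= i < N) F (2 * i).+1.
Proof.
elim: N => [|N IH]; first by rewrite muln0 !big_geq // mulr1.
have -> : (2 * N.+1 = (2 * N).+2)%N by lia.
by rewrite !big_nat_recr //= IH; ring.
Qed.

(** At half a step, the level points are the nodes of the product of twice
    the degree. *)
Lemma level_nodes_double N x :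
  \prod_(r <- level_nodes N (zol_step (2 * N))) (x - r) =
  \prod_(t <- zol_nodes (2 * N)) (x - t).
Proof.
rewrite big_cat /= !big_map big_nat_double.
congr (_ * _); apply: eq_bigr => i _; congr (x - dn l _); rewrite zol_step2.
  by rewrite !(natrD, natrM); ring.
have -> : (2 * (2 * i).+1 + 1)%:R = 2 * (2 * i.+1)%:R - 1 :> R.
  apply/eqP; rewrite eq_sym subr_eq -natrM natr1; apply/eqP; congr (_%:R); lia.
ring.
Qed.

(** With z the product of degree N and c the square of its value at half a
    step, level_nodes_double shows that the product of degree 2 N is
    (z^2 - c) / (1 - c z^2).  At a node of z its value is - c, which by
    periodicity has the modulus of its value at 1; hence c is its value at 1. *)
Lemma zol_double N : (0 < N)%N ->
  zol N 1 ^+ 2 * (1 + zol (2 * N) 1 ^+ 2) = 2 * zol (2 * N) 1.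
Proof.
move=> N0; have s0 := zol_step_gt0 N0; have N20 : (0 < 2 * N)%N by lia.
have s20 := zol_step_gt0 N20.
set et := zol N (dn l (zol_step (2 * N))) ^+ 2.
have et1 : et < 1 by rewrite sqr_zol_lt1 // dn_gt0.
have [al0 als] : 0 < zol_step (2 * N) /\ zol_step (2 * N) < zol_step N.
  by split => //; rewrite [ltRHS]zol_step2; lra.
have pen x : 0 < x ->
    zol (2 * N) x * (1 - et * zol N x ^+ 2) = zol N x ^+ 2 - et.
  move=> x0; have := zol_pencil N0 (introT andP (conj al0 als)).
  rewrite -/et => pen; have := pen x; have := pen (- x).
  rewrite !level_nodes_double.
  have neg M : \prod_(t <- zol_nodes M) (- x - t) ^+ 2 =
      \prod_(t <- zol_nodes M) (x + t) ^+ 2.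
    by apply: eq_bigr => t _; rewrite -opprD sqrrN.
  have neg' M : \prod_(t <- zol_nodes M) (- x + t) ^+ 2 =
      \prod_(t <- zol_nodes M) (x - t) ^+ 2.
    by apply: eq_bigr => t _; rewrite -[in RHS]sqrrN opprB addrC.
  have neg2 : \prod_(t <- zol_nodes (2 * N)) (- x - t) =
      \prod_(t <- zol_nodes (2 * N)) (x + t).
    under eq_bigr do rewrite -opprD -mulN1r.
    rewrite big_split /= big_const_seq count_predT size_map size_iota subn0.
    by rewrite iter_mulr_1 exprM sqrrN expr1n expr1n mul1r.
  rewrite neg neg' neg2 !prodrXl.
  have d0 := zol_den_gt0 N x0; have d20 := zol_den_gt0 (2 * N) x0.
  rewrite !zol_num_den.
  move: d0 d20 et1.
  move: (\prod_(t <- _) (x - t)) (\prod_(t <- _) (x - t)).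
  move=> p2 p; move: (\prod_(t <- _) (x + t)) (\prod_(t <- _) (x + t)).
  move=> d2 d d0 d20 et1 e1 e2.
  have n2 : d2 != 0 by rewrite gt_eqF.
  have n : d != 0 by rewrite gt_eqF.
  transitivity (p2 * (d ^+ 2 - et * p ^+ 2) / (d2 * d ^+ 2)); first by field; rewrite n n2.
  transitivity ((p ^+ 2 - et * d ^+ 2) / d ^+ 2); last by field.
  by rewrite e1 e2; field; rewrite n n2.
have et0 : 0 <= et by exact: sqr_ge0.
have etE : et = zol (2 * N) 1.
  have := pen _ (dn_gt0 l_gt0 l_lt1 (zol_step N)).
  rewrite zol_node // expr0n mulr0 subr0 mulr1 sub0r => e.
  have := sqr_zol_shift 0 N20; rewrite add0r -zol_step2 dn0 // e sqrrN => /eqP.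
  by rewrite eqrXn2 // ?(ltW (zol_gt0 _)) // => /eqP.
by have := pen 1 ltr01; rewrite etE; lra.
Qed.
End Zolotarev.

(** * The Landen transformation *)

Section Landen.
Variable R : realType.

Definition landen (l : R) : R := 2 * Num.sqrt l / (1 + l).

Variable l : R.
Hypotheses (l_gt0 : 0 < l) (l_lt1 : l < 1).

Let l1 := landen l.
Let r := Num.sqrt l.

Let rr : r ^+ 2 = l. Proof. by rewrite sqr_sqrtr // ltW. Qed.
Let r_gt0 : 0 < r. Proof. by rewrite sqrtr_gt0. Qed.
Let r_lt1 : r < 1.
Proof. by rewrite -(@ltr_pXn2r _ 2) ?nnegrE ?(ltW r_gt0) // expr1n rr. Qed.

Lemma landen_gt0 : 0 < landen l.
Proof. by rewrite /landen divr_gt0 ?mulr_gt0 ?addr_gt0. Qed.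

Lemma landen_lt1 : landen l < 1.
Proof.
rewrite /landen ltr_pdivrMr ?addr_gt0 // mul1r -/r -rr.
have : 0 < (1 - r) ^+ 2 by rewrite exprn_gt0 // subr_gt0.
lra.
Qed.

Lemma sqr_landen : landen l ^+ 2 = 4 * l / (1 + l) ^+ 2.
Proof.
rewrite /landen expr_div_n exprMn sqr_sqrtr ?(ltW l_gt0) //.
by congr (_ * _ / _); lra.
Qed.

Lemma atanV (x : R) : 0 < x -> atan x^-1 = pi / 2 - atan x.
Proof.
move=> x0.
have ax0 : 0 < atan x by rewrite -atan0 lt_atan.
have axpi := atan_ltpi2 x.
have e : tan (pi / 2 - atan x) = x^-1.
  rewrite /tan sinB cosB sin_pihalf cos_pihalf !mul1r !mul0r subr0 add0r.
  by rewrite -invf_div -/(tan (atan x)) atanK.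
by rewrite -e tanK // in_itv /=; apply/andP; split; lra.
Qed.

Definition landen_angle p := p + atan (l * tan p).

Lemma cos_gt0 (p : R) : 0 <= p < pi / 2 -> 0 < cos p.
Proof.
move=> /andP[p0 p1]; apply: cos_gt0_pihalf; rewrite p1 andbT.
by have := pi_gt0 R; lra.
Qed.

Lemma landen_angle_sincos p : 0 <= p < pi / 2 ->
  sin (landen_angle p) = (1 + l) * sin p * cos p / delta l p.
Proof.
move=> /cos_gt0 c0; have d0 := delta_gt0 l_gt0 l_lt1 p.
have ca : cos (atan (l * tan p)) = cos p / delta l p.
  rewrite cos_atan; have -> : 1 + (l * tan p) ^+ 2 = (delta l p / cos p) ^+ 2.
    rewrite expr_div_n sqr_delta // -delta_radicand // /tan.
    by field; rewrite gt_eqF.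
  by rewrite sqrtr_sqr gtr0_norm ?divr_gt0 // invf_div.
have sa : sin (atan (l * tan p)) = l * sin p / delta l p.
  have := atanK (l * tan p); rewrite {1}/tan ca => /(canRL (divfK _)) ->; last first.
    by rewrite mulf_neq0 ?invr_neq0 // gt_eqF.
  by rewrite /tan; field; rewrite !gt_eqF.
by rewrite /landen_angle sinD ca sa; ring.
Qed.

Lemma delta_landen p : 0 <= p < pi / 2 ->
  delta l1 (landen_angle p) = (delta l p ^+ 2 + l) / ((1 + l) * delta l p).
Proof.
move=> pI; have d0 := delta_gt0 l_gt0 l_lt1 p.
have l10 : 0 < 1 + l by rewrite addr_gt0.
apply/eqP; rewrite -(@eqrXn2 _ 2) //; last 2 first.
- exact/ltW/(delta_gt0 landen_gt0 landen_lt1).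
- by rewrite divr_ge0 // ?addr_ge0 ?mulr_ge0 ?sqr_ge0 // ltW.
rewrite (sqr_delta landen_gt0 landen_lt1) sqr_landen landen_angle_sincos //.
apply/eqP; rewrite !expr_div_n !exprMn.
have := sqr_delta l_gt0 l_lt1 p; have := cos2sin2 p.
have n1 : 1 + l != 0 by rewrite gt_eqF.
have n2 : delta l p != 0 by rewrite gt_eqF.
move: n1 n2; move: (delta l p) (sin p) (cos p) => d s c n1 n2 e1 e2.
transitivity ((d ^+ 2 * (1 + l) ^+ 2 - (1 - l) ^+ 2 * (1 + l) ^+ 2 * s ^+ 2 * c ^+ 2) /
    ((1 + l) ^+ 2 * d ^+ 2)); first by field; rewrite n1 n2.
by congr (_ / _); ring: e1 e2.
Qed.

Lemma is_derive_landen_angle (p : R) : 0 <= p < pi / 2 ->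
  is_derive p 1 landen_angle (1 + l / delta l p ^+ 2).
Proof.
move=> pI; have c0 := cos_gt0 pI; have d0 := delta_gt0 l_gt0 l_lt1 p.
have dt : is_derive p 1 tan ((cos p) ^- 2) by apply: is_derive_tan; rewrite gt_eqF.
have dlt : is_derive p 1 (fun p => l *: tan p) (l *: (cos p) ^- 2) by exact: is_deriveZ.
have da : is_derive p 1 (fun p => atan (l * tan p))
    ((1 + (l * tan p) ^+ 2)^-1 * (l *: (cos p) ^- 2)).
  exact: (@is_derive1_comp _ atan (fun p : R => l *: tan p)).
have -> : 1 + l / delta l p ^+ 2 = 1 + (1 + (l * tan p) ^+ 2)^-1 * (l *: (cos p) ^- 2).
  rewrite sqr_delta // -delta_radicand // /tan /GRing.scale /=.
  have : cos p ^+ 2 + l ^+ 2 * sin p ^+ 2 != 0.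
    by rewrite delta_radicand // -sqr_delta // expf_neq0 // gt_eqF.
  have := gt_eqF c0; move: (cos p) (sin p) => c s /negbT cn0 n0; field.
  by rewrite cn0 ?andbT /=; apply: contra_neq n0 => <-; ring.
exact: is_deriveD.
Qed.

(** The amplitude p + atan (l tan p) has derivative (delta^2 + l) / delta^2, and
    delta_landen turns this into (1 + l) times a quotient of the two integrands. *)
Lemma ellF_landen p : 0 <= p < pi / 2 ->
  ellF l1 (landen_angle p) = (1 + l) * ellF l p.
Proof.
move=> /andP[p0 p1]; pose G q := ellF l1 (landen_angle q) - (1 + l) *: ellF l q.
have dG (x : R) : 0 <= x <= p -> is_derive x 1 G (cst 0 x).
  move=> /andP[x0 xp]; have xI : 0 <= x < pi / 2 by rewrite x0 (le_lt_trans xp).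
  have d0 := delta_gt0 l_gt0 l_lt1 x.
  have dA := is_derive1_comp (is_derive_ellF landen_gt0 landen_lt1 (landen_angle x))
    (is_derive_landen_angle xI).
  have dB := @is_deriveZ _ _ _ _ (1 + l) _ _ _ (is_derive_ellF l_gt0 l_lt1 x).
  have := @is_deriveB _ _ _ _ _ _ _ _ _ dA dB.
  rewrite /cst delta_landen // /GRing.scale /=.
  have n1 : (delta l x ^+ 2 + l) != 0 by rewrite gt_eqF // addr_gt0 // exprn_gt0.
  have n2 : 1 + l != 0 by rewrite gt_eqF // addr_gt0.
  have n3 : delta l x != 0 by rewrite gt_eqF.
  have -> : ((delta l x ^+ 2 + l) / ((1 + l) * delta l x))^-1 * (1 + l / delta l x ^+ 2) -
     (1 + l) / delta l x = 0 by field; rewrite n1 n2 n3.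
  exact.
have [c _] := derive_mvt p0 dG.
rewrite /G /cst mul0r /landen_angle tan0 mulr0 atan0 addr0 !ellF0 scaler0 subr0.
by rewrite /GRing.scale /= subr0 => /eqP; rewrite subr_eq0 => /eqP.
Qed.

(** The value at the midpoint is fixed by the involution x -> l / x of dnDK. *)
Lemma dn_half_ellI : dn l (ellI l / 2) = r.
Proof.
have d0 := dn_gt0 l_gt0 l_lt1 (ellI l / 2).
have := dnDK l_gt0 l_lt1 (- (ellI l / 2)).
have -> : - (ellI l / 2) + ellI l = ellI l / 2 by lra.
rewrite dnN // => e; apply/eqP; rewrite -(@eqrXn2 _ 2) // ?(ltW d0) ?(ltW r_gt0) //.
by rewrite rr expr2 {1}e divfK // gt_eqF.
Qed.

(** The amplitude of half the quarter period. *)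
Definition half_angle := atan r^-1.

Lemma half_angleP : 0 <= half_angle < pi / 2.
Proof. by rewrite /half_angle atan_ltpi2 andbT -atan0 le_atan // invr_ge0 ltW. Qed.

Lemma sin_cos_half_angle :
  cos half_angle = r / Num.sqrt (1 + l) /\ sin half_angle = (Num.sqrt (1 + l))^-1.
Proof.
have c : cos half_angle = r / Num.sqrt (1 + l).
  rewrite /half_angle cos_atan; have -> : 1 + r^-1 ^+ 2 = (1 + l) / r ^+ 2.
    by rewrite -{1}rr; field; rewrite gt_eqF.
  rewrite sqrtrM ?addr_ge0 ?(ltW l_gt0) // sqrtrV ?sqr_ge0 // sqrtr_sqr gtr0_norm //.
  by rewrite invf_div.
split => //; have := atanK r^-1; rewrite -/half_angle /tan c.
move/(canRL (divfK _)) => ->; first by field; rewrite !gt_eqF ?sqrtr_gt0 ?addr_gt0.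
by rewrite mulf_neq0 ?invr_neq0 // gt_eqF ?sqrtr_gt0 ?addr_gt0.
Qed.

Lemma ellF_half_angle : ellF l half_angle = ellI l / 2.
Proof.
have /andP[h0 h1] := half_angleP.
have K0 := ellI_gt0 l_gt0 l_lt1.
have e : dn l (ellF l half_angle) = dn l (ellI l / 2).
  rewrite dn_half_ellI /dn ellFK //; have [c s] := sin_cos_half_angle.
  have l10 : 0 < 1 + l by rewrite addr_gt0.
  rewrite /delta c s !expr_div_n exprVn !sqr_sqrtr ?(ltW l10) ?(ltW l_gt0) //.
  have -> : l / (1 + l) + l ^+ 2 / (1 + l) = l by field; rewrite gt_eqF.
  by [].
have u0 : 0 <= ellF l half_angle by rewrite -(ellF0 l) ler_ellF.
have uK : ellF l half_angle <= ellI l by rewrite ler_ellF // ltW.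
case: (ltgtP (ellF l half_angle) (ellI l / 2)) => // h.
  by have := dn_lt l_gt0 l_lt1 u0 h; rewrite e ltxx => /(_ ltac:(lra)).
have hh : 0 <= ellI l / 2 by lra.
by have := dn_lt l_gt0 l_lt1 hh h uK; rewrite e ltxx.
Qed.

(** The Landen image of half_angle is a right angle, because atan (1 / r) and
    atan r are complementary. *)
Lemma ellI_landen : ellI l1 = (1 + l) / 2 * ellI l.
Proof.
have -> : (1 + l) / 2 * ellI l = (1 + l) * (ellI l / 2) by lra.
rewrite -ellF_half_angle -ellF_landen ?half_angleP //; congr ellF.
rewrite /landen_angle /half_angle atanK.
have -> : l * r^-1 = r by rewrite -{1}rr; field; rewrite gt_eqF.
by rewrite atanV // subrK.
Qed.

Lemma dn_landen u : 0 <= u < ellI l -> dn l1 ((1 + l) * u) = (dn l u + l / dn l u) / (1 + l).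
Proof.
move=> /andP[u0 uK].
have aI : 0 <= am l u < pi / 2.
  by rewrite -{1}(am0 l_gt0 l_lt1) -(amK_ellI l_gt0 l_lt1) leNgt !ltr_am // -leNgt u0.
rewrite -{1}(amK l_gt0 l_lt1 u) -ellF_landen //.
rewrite {1}/dn (ellFK landen_gt0 landen_lt1) delta_landen // -/(dn l u).
have d0 := dn_gt0 l_gt0 l_lt1 u.
by field; rewrite !gt_eqF // addr_gt0.
Qed.

(** The nodes of parameters u and K - u have product l.  Their two factors at
    1 combine into the factor of the node (t + l / t) / (1 + l), which is again a
    value of dn by dn_landen. *)
Lemma zol_landen N : (0 < N)%N -> zol l (2 * N) 1 = zol l1 N 1.
Proof.
move=> N0; have N20 : (0 < 2 * N)%N by lia.
rewrite !zolE.
have -> : (2 * N = N + N)%N by lia.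
rewrite [LHS](big_cat_nat (n := N)) ?leq_addr //=.
have shiftN (G : nat -> R) : \prod_(N <= i < N + N) G i =
    \prod_(0 <= i < N) G (N + (N + N) - (i + N).+1)%N.
  by rewrite big_nat_rev /= -{1}[N]add0n big_addn addnK.
rewrite shiftN -big_split /=; apply: eq_big_nat => i /andP[_ iN].
have -> : (N + N = 2 * N)%N by lia.
set st := zol_step l (2 * N).
have st0 : 0 < st by exact: zol_step_gt0.
have stK : (2 * (2 * N))%:R * st = ellI l by exact: zol_stepK.
have st1 : zol_step l1 N = (1 + l) * st.
  rewrite /st /zol_step ellI_landen !natrM.
  have : N%:R != 0 :> R by rewrite pnatr_eq0 -lt0n.
  by move: (N%:R) => k k0; field.
set u := (2 * i + 1)%:R * st.
have -> : (2 * (N + 2 * N - (i + N).+1) + 1)%:R * st = - u + ellI l.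
  rewrite -stK /u -mulNr -mulrDl; congr (_ * _).
  apply/eqP; rewrite eq_sym addrC subr_eq -natrD; apply/eqP; congr (_%:R); lia.
have -> : (2 * i + 1)%:R * zol_step l1 N = (1 + l) * u by rewrite st1 /u; ring.
have uI : 0 <= u < ellI l.
  rewrite /u mulr_ge0 ?(ltW st0) //= -stK ltr_pM2r // ltr_nat; lia.
rewrite dnDK // dnN // dn_landen //.
have := dn_gt0 l_gt0 l_lt1 u; move: (dn l u) l_gt0 => t l0 t0.
by field; rewrite !gt_eqF //=; nra.
Qed.

Lemma ellI_ge : pi / 2 <= ellI l.
Proof.
have p0 : 0 <= pi / 2 :> R by rewrite divr_ge0 ?pi_ge0.
by have := ellFB_ge l_gt0 l_lt1 p0; rewrite ellF0 !subr0.
Qed.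

(** The integrand is at most the secant, of which the right-hand side is a
    primitive. *)
Lemma ellF_le_ln p : 0 <= p < pi / 2 -> ellF l p <= ln ((1 + sin p) / cos p).
Proof.
move=> /andP[p0 p1]; pose H q := ln ((1 + sin q) * (cos q)^-1) - ellF l q.
have dH (x : R) : 0 <= x <= p -> is_derive x 1 H ((cos x)^-1 - (delta l x)^-1).
  move=> /andP[x0 xp]; have xI : 0 <= x < pi / 2 by rewrite x0 (le_lt_trans xp).
  have c0 := cos_gt0 xI; have cn0 : cos x != 0 by rewrite gt_eqF.
  have s0 : 0 <= sin x by apply: sin_ge0_pi; rewrite x0; have := pi_gt0 R; lra.
  have dV := is_deriveV cn0 (is_derive_cos x).
  have dN : is_derive x 1 (fun q : R => 1 + sin q) (0 + cos x) by exact: is_deriveD.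
  have dM := is_deriveM dN dV.
  have q0 : 0 < (1 + sin x) * (cos x)^-1 by rewrite divr_gt0 // ltr_pwDl.
  have dL := @is_derive1_comp R (@ln R) (fun q : R => (1 + sin q) * (cos q)^-1)
    x _ _ (is_derive1_ln q0) dM.
  have dB := is_deriveB dL (is_derive_ellF l_gt0 l_lt1 x).
  apply: (is_derive_eq dB); congr (_ - _).
  rewrite /GRing.scale /=; have := cos2sin2 x.
  have n1 : 1 + sin x != 0 by rewrite gt_eqF // ltr_pwDl.
  move: n1 cn0; move: (cos x) (sin x) => c s n1 n2 e.
  transitivity (((1 + s) * s + c ^+ 2) / (c * (1 + s))); first by field; rewrite n1 n2.
  by rewrite e; field; rewrite n1 n2.
have [c /andP[c0 cp]] := derive_mvt p0 dH.
rewrite /H sin0 cos0 addr0 invr1 mulr1 ln1 ellF0 !subr0 => e.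
rewrite -subr_ge0 e mulr_ge0 // subr_ge0.
have cI : 0 <= c < pi / 2 by rewrite c0 (le_lt_trans cp).
have d0 := delta_gt0 l_gt0 l_lt1 c.
rewrite lef_pV2 ?posrE ?cos_gt0 //.
rewrite -(@ler_pXn2r _ 2) ?nnegrE ?(ltW (cos_gt0 cI)) ?(ltW d0) //.
by rewrite sqr_delta // -delta_radicand // lerDl mulr_ge0 ?sqr_ge0.
Qed.

(** Doubling the integral up to half_angle avoids the pole of the secant. *)
Lemma ellI_le : ellI l <= ln (9 / l).
Proof.
have l10 : 0 < 1 + l by rewrite addr_gt0.
have c0 : 0 < Num.sqrt (1 + l) by rewrite sqrtr_gt0.
have := ellF_le_ln half_angleP; rewrite ellF_half_angle.
have [-> ->] := sin_cos_half_angle.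
have -> : (1 + (Num.sqrt (1 + l))^-1) / (r / Num.sqrt (1 + l)) = (Num.sqrt (1 + l) + 1) / r.
  by field; rewrite !gt_eqF.
set q := _ / r => h.
have q0 : 0 < q by rewrite divr_gt0 // addr_gt0.
have -> : ellI l = 2 * (ellI l / 2) by lra.
apply: (@le_trans _ _ (2 * ln q)); first by lra.
rewrite mulr_natl -lnXn // ler_ln ?posrE ?exprn_gt0 ?divr_gt0 //.
rewrite /q expr_div_n rr ler_pM2r ?invr_gt0 //.
have c2 : Num.sqrt (1 + l) <= 2.
  rewrite -(@ler_pXn2r _ 2) ?nnegrE ?sqrtr_ge0 // sqr_sqrtr ?(ltW l10) //.
  by move: l_lt1; lra.
by move: c0 c2; nra.
Qed.
End Landen.

(** * The complete elliptic integral *)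

Section EllipticK.
Local Open Scope classical_set_scope.
Variable R : realType.
Local Notation mu := (@lebesgue_measure R).

Definition comodulus (l : R) := Num.sqrt (1 - l ^+ 2).

Lemma comodulusP l : 0 < l < 1 -> 0 < comodulus l < 1.
Proof.
move=> /andP[l0 l1]; rewrite sqrtr_gt0 subr_gt0 expr_lt1 ?(ltW l0) // l1 /=.
rewrite -(@ltr_pXn2r _ 2) ?nnegrE ?sqrtr_ge0 // sqr_sqrtr ?expr1n.
  by rewrite gtrBl exprn_gt0.
by rewrite subr_ge0 expr_le1 ?ltW.
Qed.

Lemma sqr_comodulus l : 0 < l < 1 -> comodulus l ^+ 2 = 1 - l ^+ 2.
Proof. by move=> /andP[l0 l1]; rewrite sqr_sqrtr // subr_ge0 expr_le1 // ltW. Qed.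

Lemma comodulusK l : 0 < l < 1 -> comodulus (comodulus l) = l.
Proof.
move=> lI; rewrite /comodulus -/(comodulus l) sqr_comodulus // subKr.
by case/andP: lI => l0 _; rewrite sqrtr_sqr gtr0_norm.
Qed.

(** The substitution t = sin p.  The integrand is singular at 1, so the
    integral is a limit of integrals up to sin (pi / 2 - 1 / (n + 2)), by monotone
    convergence. *)
Lemma ellipticKE (l : R) : 0 < l < 1 -> ellipticK l = ellI (comodulus l).
Proof.
move=> lI; have /andP[l0 l1] := lI; have /andP[c0 c1] := comodulusP lI.
set c := comodulus l in c0 c1 *.
pose f (t : R) : R := (Num.sqrt ((1 - t ^+ 2) * (1 - l ^+ 2 * t ^+ 2)))^-1.
pose F t := ellF c (asin t).
have rad t : -1 < t < 1 -> 0 < (1 - t ^+ 2) * (1 - l ^+ 2 * t ^+ 2).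
  move=> /andP[t0 t1]; have t2 : t ^+ 2 < 1 by nra.
  have l2 : l ^+ 2 < 1 by nra.
  by have := sqr_ge0 t; have := sqr_ge0 l => h1 h2; apply: mulr_gt0; nra.
have dF (t : R) : -1 < t < 1 -> is_derive t 1 F (f t).
  move=> tI; have := is_derive1_comp (is_derive_ellF c0 c1 (asin t)) (is_derive1_asin tI).
  suff -> : f t = (delta c (asin t))^-1 * (Num.sqrt (1 - t ^+ 2))^-1 by [].
  have tI' : t \in `[(-1), 1]%R by rewrite in_itv /=; case/andP: tI => *; rewrite !ltW.
  have t2 : 0 <= 1 - t ^+ 2 by case/andP: tI => *; nra.
  rewrite /delta delta_radicand asinK // sqr_comodulus // subKr.
  by rewrite /f sqrtrM // invfM mulrC.
have cf (t : R) : -1 < t < 1 -> {for t, continuous f}.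
  move=> tI; apply: continuousV; first by rewrite gt_eqF // sqrtr_gt0 rad.
  apply: continuous_comp; last exact: sqrt_continuous.
  apply: continuousM; apply: continuousB; try exact: cst_continuous.
    exact: exprn_continuous.
  by apply: continuousM; [exact: cst_continuous | exact: exprn_continuous].
pose e n : R := n.+2%:R^-1.
have e0 n : 0 < e n by rewrite invr_gt0.
have e1 n : e n <= 2^-1 by rewrite lef_pV2 ?posrE // ler_nat.
have pi2 : 1 <= pi / 2 :> R by have := @pi_ge2 R; lra.
pose b n : R := sin (pi / 2 - e n).
have aI n : pi / 2 - e n \in `[(- (pi / 2)), (pi / 2)]%R.
  by rewrite in_itv /=; have := e0 n; have := e1 n => h1 h2; apply/andP; split; lra.
have ab n : asin (b n) = pi / 2 - e n by rewrite sinK.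
have b0 n : 0 < b n.
  by apply: sin_gt0_pi; have := e0 n; have := e1 n => h1 h2; apply/andP; split; lra.
have piI : (pi / 2 : R) \in `[(- (pi / 2)), (pi / 2)]%R.
  by rewrite in_itv /=; apply/andP; split; lra.
have b1 n : b n < 1.
  by rewrite -(@sin_pihalf R) (ltr_sin (aI n) piI); have := e0 n; lra.
have intb n : (\int[mu]_(t in `[0%R, b n]) (f t)%:E)%E = (F (b n) - F 0)%:E.
  have Ib t : 0 <= t <= b n -> -1 < t < 1.
    by move=> /andP[t0 tb]; have := b1 n => h; apply/andP; split; lra.
  have cF (t : R) : -1 < t < 1 -> {for t, continuous F}.
    by move=> tI; apply/differentiable_continuous/derivable1_diffP; case: (dF t tI).
  rewrite EFinB; apply: continuous_FTC2 => //.
  - apply: continuous_in_subspaceT => t; rewrite inE /= in_itv /= => tb.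
    exact/cf/Ib.
  - split.
    + move=> t; rewrite in_itv /= => /andP[t0 tb].
      by case: (dF t _) => //; apply: Ib; rewrite !ltW.
    + by apply: cvg_at_right_filter; apply: cF; rewrite ltr01 andbT; lra.
    + by apply: cvg_at_left_filter; apply: cF; apply: Ib; rewrite lexx ltW.
  - move=> t; rewrite in_itv /= => /andP[t0 tb]; rewrite derive1E.
    have tI : -1 < t < 1 by apply: Ib; rewrite !ltW.
    by have := dF t tI => d; rewrite derive_val.
have mf (A : set R) : A `<=` `](-1), 1[ -> measurable_fun A f.
  move=> sA; apply: (measurable_funS _ sA) => //.
  apply: open_continuous_measurable_fun => //.
  by move=> t; rewrite inE /= in_itv /=; exact: cf.
have cup : \bigcup_n `[0, b n] = `[0, 1[ :> set R.
  apply/seteqP; split => t.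
    by move=> [n _] /=; rewrite !in_itv /= => /andP[-> /le_lt_trans]; exact.
  rewrite /= in_itv /= => /andP[t0 t1].
  have tI : -1 < t < 1 by rewrite t1 andbT; lra.
  have at1 : asin t < pi / 2 by apply: asin_ltpi2; rewrite t1 andbT; lra.
  have d0 : 0 < pi / 2 - asin t by lra.
  pose n := Num.bound (pi / 2 - asin t)^-1.
  have en : e n < pi / 2 - asin t.
    rewrite -[ltRHS]invrK ltf_pV2 ?posrE ?invr_gt0 //.
    apply: (lt_trans (archi_boundP _)); first by rewrite invr_ge0 ltW.
    by rewrite ltr_nat -/n; lia.
  exists n => //; rewrite /= in_itv /= t0 /=.
  have tI' : t \in `[(-1), 1]%R by rewrite in_itv /=; apply/andP; split; lra.
  have atI : asin t \in `[(- (pi / 2)), (pi / 2)]%R.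
    by rewrite in_itv /= asin_geNpi2 ?asin_lepi2 //; apply/andP; split; lra.
  rewrite -(asinK tI') ltW // /b (ltr_sin atI (aI n)); lra.
have cvgL : (\int[mu]_(t in `[0%R, b i]) (f t)%:E)%E @[i --> \oo] -->
    (\int[mu]_(t in \bigcup_n `[0%R, b n]) (f t)%:E)%E.
  apply: ge0_nondecreasing_set_cvg_integral => //.
  - move=> i j ij; apply/subsetPset; apply: subset_itvl; rewrite bnd_simp.
    rewrite /b leNgt (ltr_sin (aI j) (aI i)) -leNgt lerD2l lerN2.
    by rewrite /e lef_pV2 ?posrE // ler_nat; lia.
  - move=> i; apply/measurable_EFinP; apply: mf.
    apply: subset_itv; rewrite bnd_simp; first lra.
    exact: b1.
  - by move=> i t _; rewrite lee_fin invr_ge0 sqrtr_ge0.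
have cvgR : (\int[mu]_(t in `[0%R, b i]) (f t)%:E)%E @[i --> \oo] --> (ellI c)%:E.
  have asin0 : asin (0 : R) = 0.
    by rewrite -[in LHS](@sin0 R) sinK // in_itv /=; apply/andP; split; lra.
  have FE n : F (b n) - F 0 = ellF c (pi / 2 - e n).
    by rewrite /F ab asin0 ellF0 subr0.
  have lim : ellF c (pi / 2 - e n) @[n --> \oo] --> ellI c.
    rewrite /ellI; apply: continuous_cvg; first exact: continuous_ellF.
    rewrite -[X in _ --> X]subr0; apply: cvgB; first exact: cvg_cst.
    have -> : e = (fun n => harmonic n.+1) by [].
    by rewrite cvg_shiftS; exact: cvg_harmonic.
  under eq_fun do rewrite intb FE.
  by apply: cvg_EFin; [exact: nearW | exact: lim].
have -> : ellipticK l = fine (\int[mu]_(t in `[0%R, 1%R]) (f t)%:E)%E by [].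
rewrite -integral_itv_bndo_bndc; last first.
  by apply/measurable_EFinP; apply: mf; apply: subset_itvr; rewrite bnd_simp; lra.
by rewrite -cup (cvg_unique _ cvgL cvgR).
Qed.
End EllipticK.

(** * The rate of decay of Zolotarev products *)

Section Bounds.
Variable R : realType.
Implicit Types l : R.

(** Turns a crude uniform bound into a sharp one when a Landen step at least
    squares the quantity to be bounded. *)
Lemma le1_of_bounded_powers (x C : R) : 0 <= x ->
  (forall M : nat, x ^+ (2 ^ M) <= C) -> x <= 1.
Proof.
move=> x0 xC; rewrite leNgt; apply/negP => x1.
have bern n : 1 + n%:R * (x - 1) <= x ^+ n.
  elim: n => [|n IH]; first by rewrite mul0r addr0 expr0.
  rewrite exprS; apply: (le_trans _ (ler_wpM2l x0 IH)).
  have : 0 <= n%:R * (x - 1) ^+ 2 by rewrite mulr_ge0 ?sqr_ge0.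
  by rewrite -natr1; lra.
have d0 : 0 < x - 1 by rewrite subr_gt0.
pose M := Num.bound `|C / (x - 1)|.
have CM : C < M%:R * (x - 1).
  by rewrite -ltr_pdivrMr // (le_lt_trans (ler_norm _)) // archi_boundP.
have : M%:R <= (2 ^ M)%:R :> R by rewrite ler_nat ltnW // ltn_expl.
have := bern (2 ^ M)%N; have := xC M; nra.
Qed.

(** This is pi K (l) / K (sqrt (1 - l^2)), that is pi^2 / (2 mu (l)); see
    rate_grotzsch. *)
Definition rate l := pi * ellI (comodulus l) / ellI l.

Lemma grotzsch_muE l : 0 < l < 1 ->
  grotzsch_mu l = pi / 2 * (ellI l / ellI (comodulus l)).
Proof.
move=> lI; rewrite /grotzsch_mu -/(comodulus l) !ellipticKE ?comodulusP //.
by rewrite comodulusK.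
Qed.

Lemma ellI_pos l : 0 < l < 1 -> 0 < ellI l.
Proof. by move=> /andP[l0 l1]; exact: ellI_gt0. Qed.

Lemma grotzsch_mu_gt0 l : 0 < l < 1 -> 0 < grotzsch_mu l.
Proof.
move=> lI; rewrite grotzsch_muE // mulr_gt0 ?divr_gt0 ?pi_gt0 ?ellI_pos //.
exact: comodulusP.
Qed.

Lemma rate_grotzsch l : 0 < l < 1 -> rate l = pi ^+ 2 / (2 * grotzsch_mu l).
Proof.
move=> lI; rewrite grotzsch_muE // /rate.
have h1 := ellI_pos lI; have h2 := ellI_pos (comodulusP lI).
have := pi_gt0 R; move: (@pi R) => p p0.
by field; rewrite !gt_eqF.
Qed.

Lemma landenP l : 0 < l < 1 -> 0 < landen l < 1.
Proof. by move=> /andP[l0 l1]; rewrite landen_gt0 // landen_lt1. Qed.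

(** The complementary modulus conjugates the Landen map to its inverse, which
    is thus explicit. *)
Lemma landen_inv l : 0 < l < 1 ->
  let v := (1 - l) / (1 + l) in
  [/\ 0 < v < 1, landen v = comodulus l & comodulus (landen l) = v].
Proof.
move=> lI; have /andP[l0 l1] := lI; move=> v.
have l10 : 0 < 1 + l by rewrite addr_gt0.
have v0 : 0 < v by rewrite divr_gt0 // subr_gt0.
have v1 : v < 1 by rewrite ltr_pdivrMr // mul1r; lra.
have n1 : 1 + l != 0 by rewrite gt_eqF.
split; first by rewrite v0.
  have /andP[c0 _] := comodulusP lI.
  apply/eqP; rewrite -(@eqrXn2 _ 2) ?(ltW c0) ?(ltW (landen_gt0 _)) //.
  rewrite sqr_landen // sqr_comodulus // /v; apply/eqP; field.
  by rewrite n1 gt_eqF //; lra.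
rewrite /comodulus sqr_landen //.
have -> : 1 - 4 * l / (1 + l) ^+ 2 = v ^+ 2 by rewrite /v; field.
by rewrite sqrtr_sqr gtr0_norm.
Qed.

Lemma ellI_comodulus_landen l : 0 < l < 1 ->
  ellI (comodulus (landen l)) = (1 + l) * ellI (comodulus l).
Proof.
move=> lI; have /andP[l0 l1] := lI; have [/andP[v0 v1] <- ->] := landen_inv lI.
rewrite ellI_landen //.
have n1 : 1 + l != 0 by rewrite gt_eqF // addr_gt0.
by move: (ellI _) => k; field.
Qed.

Lemma rate_landen l : 0 < l < 1 -> rate (landen l) = 2 * rate l.
Proof.
move=> lI; have /andP[l0 l1] := lI; rewrite /rate ellI_comodulus_landen // ellI_landen //.
have := ellI_pos lI; move: (ellI l) (ellI (comodulus l)) => k k' k0.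
by field; rewrite !gt_eqF // addr_gt0.
Qed.

Lemma grotzsch_mu_landen l : 0 < l < 1 -> grotzsch_mu (landen l) = grotzsch_mu l / 2.
Proof.
move=> lI; have /andP[l0 l1] := lI.
rewrite !grotzsch_muE ?landenP // ellI_comodulus_landen // ellI_landen //.
have := ellI_pos (comodulusP lI); move: (ellI l) (ellI (comodulus l)) => k k' k0.
by field; rewrite !gt_eqF // addr_gt0.
Qed.

(** It only matters that the bound does not depend on l.  The logarithmic
    growth of K at 1 has exactly the coefficient which makes this possible. *)
Lemma expR_rate_le l : 0 < l < 1 -> (1 - l) * expR (rate l) <= 81.
Proof.
move=> lI; have /andP[l0 l1] := lI; have cI := comodulusP lI.
have /andP[c0 c1] := cI; have k0 := ellI_pos lI; have k0' := ellI_pos cI.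
have h : rate l <= ln ((9 / comodulus l) ^+ 2).
  rewrite lnXn ?divr_gt0 // -[leRHS]mulr_natl.
  apply: (@le_trans _ _ (2 * ellI (comodulus l))); last first.
    by rewrite ler_pM2l // ellI_le.
  rewrite /rate ler_pdivrMr // mulrAC ler_pM2r //.
  have := ellI_ge l0 l1; lra.
have e0 : 0 < (9 / comodulus l) ^+ 2 by rewrite exprn_gt0 // divr_gt0.
apply: (@le_trans _ _ ((1 - l) * (9 / comodulus l) ^+ 2)).
  by rewrite ler_pM2l ?subr_gt0 // -[leRHS]lnK ?posrE // ler_expR.
rewrite expr_div_n sqr_comodulus //.
have -> : 1 - l ^+ 2 = (1 - l) * (1 + l) by ring.
have n0 : 1 - l != 0 by rewrite gt_eqF // subr_gt0.
have -> : (1 - l) * (9 ^+ 2 / ((1 - l) * (1 + l))) = 81 / (1 + l).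
  by field; rewrite n0 gt_eqF // addr_gt0.
by rewrite ler_pdivrMr ?addr_gt0 //; nra.
Qed.

(** A l below squares, at least, when l is replaced by landen l; since it is
    bounded independently of l, it is at most 1. *)
Theorem zol_le_rate l N : 0 < l < 1 -> (0 < N)%N ->
  zol l N 1 <= 2 * expR (rate l) ^- N.
Proof.
move=> lI N0; pose A l := zol l N 1 / 2 * expR (rate l) ^+ N.
have A0 l' : 0 < l' < 1 -> 0 <= A l'.
  by move=> /andP[l0 l1]; rewrite mulr_ge0 ?exprn_ge0 ?expR_ge0 // divr_ge0 // ltW // zol_gt0.
(* From zol_double and zol_landen; the rate doubles. *)
have A_landen l' : 0 < l' < 1 -> A l' ^+ 2 <= A (landen l').
  move=> lI'; have /andP[l0 l1] := lI'.
  have e : zol l' N 1 ^+ 2 <= 2 * zol (landen l') N 1.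
    rewrite -zol_landen // -zol_double // ler_peMr ?sqr_ge0 // lerDl sqr_ge0 //.
  rewrite /A rate_landen // expRM_natl exprAC exprMn.
  have : 0 < (expR (rate l') ^+ N) ^+ 2 by rewrite !exprn_gt0 // expR_gt0.
  move: ((expR (rate l') ^+ N) ^+ 2) => E E0.
  by rewrite ler_pM2r //; lra.
have A_le l' : 0 < l' < 1 -> A l' <= 81 ^+ N.
  move=> lI'; have /andP[l0 l1] := lI'.
  have e0 := expR_gt0 (rate l').
  have z0 := zol_gt0 l0 l1 N.
  apply: (@le_trans _ _ (zol l' N 1 * expR (rate l') ^+ N)).
    by rewrite ler_pM2r ?exprn_gt0 //; lra.
  apply: (@le_trans _ _ ((1 - l') ^+ N * expR (rate l') ^+ N)).
    by rewrite ler_pM2r ?exprn_gt0 // zol_le.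
  rewrite -exprMn; apply: lerXn2r; rewrite ?nnegrE ?expR_rate_le //.
  by rewrite mulr_ge0 ?(ltW e0) // subr_ge0 ltW.
have Ap M : forall l', 0 < l' < 1 -> A l' ^+ (2 ^ M) <= 81 ^+ N.
  elim: M => [|M IH] l' lI'; first by rewrite expn0 expr1 A_le.
  rewrite expnS exprM (le_trans _ (IH _ (landenP lI'))) //.
  by apply: lerXn2r; rewrite ?nnegrE ?exprn_ge0 ?A0 ?A_landen ?landenP.
have := le1_of_bounded_powers (A0 _ lI) (fun M => Ap M _ lI).
have E0 : 0 < expR (rate l) ^+ N by rewrite exprn_gt0 ?expR_gt0.
by rewrite /A -ler_pdivlMr // div1r; lra.
Qed.

(** The difference D of the two sides at least doubles when l is replaced by
    its preimage under landen, and it is bounded above; hence it is nonpositive. *)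
Theorem grotzsch_mu_le_ln l : 0 < l < 1 -> grotzsch_mu l <= ln (4 / l).
Proof.
pose D l := grotzsch_mu l - ln (4 / l).
have D_le l' : 0 < l' < 1 -> D l' <= ln 9.
  move=> lI; have /andP[l0 l1] := lI; have cI := comodulusP lI; have /andP[c0 c1] := cI.
  have h1 : grotzsch_mu l' <= ellI l'.
    rewrite grotzsch_muE // mulrA ler_pdivrMr ?ellI_pos // mulrC ler_pM2l ?ellI_pos //.
    exact: ellI_ge.
  have h2 := ellI_le l0 l1.
  have h3 : ln (9 / l') = ln 9 - ln l' by rewrite ln_div ?posrE.
  have h4 : ln (4 / l') = ln 4 - ln l' by rewrite ln_div ?posrE.
  have h5 : 0 <= ln 4 :> R by rewrite ln_ge0 //; lra.
  rewrite /D; lra.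
(* The preimage v of l' satisfies l'^2 = 4 v / (1 + v)^2 <= 4 v. *)
have D_desc l' : 0 < l' < 1 -> exists2 l0, 0 < l0 < 1 & 2 * D l' <= D l0.
  move=> lI; have [vI vE _] := landen_inv (comodulusP lI).
  rewrite comodulusK // in vE; exists ((1 - comodulus l') / (1 + comodulus l')) => //.
  set v := _ / _ in vI vE *; clearbody v; have /andP[v0 v1] := vI; have /andP[l0 l1] := lI.
  rewrite /D -[in grotzsch_mu l']vE grotzsch_mu_landen //.
  have : ln (4 / v) <= ln ((4 / l') ^+ 2).
    rewrite ler_ln ?posrE ?exprn_gt0 ?divr_gt0 // expr_div_n -vE sqr_landen //.
    have v1' : 1 + v != 0 by rewrite gt_eqF // addr_gt0.
    have -> : 4 ^+ 2 / (4 * v / (1 + v) ^+ 2) = 4 * (1 + v) ^+ 2 / v.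
      by field; rewrite v1' gt_eqF.
    by rewrite ler_pM2r ?invr_gt0 //; nra.
  rewrite lnXn ?divr_gt0 // -[X in _ <= X]mulr_natl; lra.
move=> lI; suff : D l <= 0 by rewrite /D subr_le0.
rewrite -ler_expR expR0.
apply: (@le1_of_bounded_powers _ (expR (ln 9))); first exact: expR_ge0.
move=> M; elim: M l lI => [|M IH] l lI; first by rewrite expn0 expr1 ler_expR D_le.
have [l0 lI0 h] := D_desc _ lI.
rewrite expnS exprM (le_trans _ (IH _ lI0)) //.
by apply: lerXn2r; rewrite ?nnegrE ?exprn_ge0 ?expR_ge0 // -expRM_natl ler_expR.
Qed.

End Bounds.

(** * Singular value decay of Pick matrices *)

Unset Implicit Arguments.
Set Strict Implicit.
Local Open Scope complex_scope.

Theorem corollary4p1 (R : realType) (a b : R) (a_gt0 : 0 < a) (ab : a < b)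
    (n : nat) (x : 'I_n -> R)
    (x_incr : forall i j : 'I_n, (i < j)%N -> x i < x j)
    (x_ab : forall i : 'I_n, a <= x i <= b)
    (s : 'cV[R[i]]_n) (j k : nat) (j_ge1 : (1 <= j)%N)
    (jk_len : (j + 2 * k <= n)%N) :
  sigma (pick_mx x s) (j + 2 * k) <=
    4 * (expR (pi ^+ 2 / (2 * grotzsch_mu (a / b)))) ^- (2 * k)
      * sigma (pick_mx x s) j
  /\
  sigma (pick_mx x s) (j + 2 * k) <=
    4 * (expR (pi ^+ 2 / (2 * ln (4 * b / a)))) ^- (2 * k)
      * sigma (pick_mx x s) j.
Proof.
have b_gt0 : 0 < b by exact: lt_trans ab.
have lI : 0 < a / b < 1 by rewrite divr_gt0 //= ltr_pdivrMr // mul1r.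
have /andP[l0 l1] := lI; set l := a / b in lI l0 l1 *.
have x_gt0 i : 0 < x i by case/andP: (x_ab i) => /(lt_le_trans a_gt0).
pose t := [seq b * u | u <- zol_nodes l k].
have t_gt0 u : u \in t -> 0 < u.
  by case/mapP => v /(zol_nodesP l0 l1)/andP[lv _] ->; rewrite mulr_gt0 // (lt_le_trans l0).
have st : size t = k by rewrite !size_map size_iota subn0.
have ft i : `|blaschke t (x i)| <= 2 * expR (rate l) ^- k.
  have -> : blaschke t (x i) = zol l k (x i / b).
    rewrite /zol /blaschke big_map; apply: eq_big_seq => u /(zol_nodesP l0 l1)/andP[lu _].
    field; have u0 := lt_le_trans l0 lu; have xi0 := x_gt0 i.
    by rewrite !gt_eqF ?addr_gt0 ?mulr_gt0.
  have [->|k0] := posnP k.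
    by rewrite /zol /blaschke big_nil normr1 expr0 invr1 mulr1; lra.
  apply: (le_trans (zol_bound l0 l1 k0 _)); last exact: zol_le_rate.
  case/andP: (x_ab i) => ax xb; rewrite /l ler_pM2r ?invr_gt0 // ax /=.
  by rewrite ler_pdivrMr // mul1r.
have := sigma_compression ft (rank_blaschke s x_gt0 t_gt0) j_ge1.
rewrite st => /(_ jk_len) main.
have first_bound : sigma (pick_mx x s) (j + 2 * k) <=
    4 * (expR (pi ^+ 2 / (2 * grotzsch_mu l))) ^- (2 * k) * sigma (pick_mx x s) j.
  move: main; rewrite rate_grotzsch // exprMn exprVn -exprM (mulnC k 2).
  by have -> : 2 ^+ 2 = 4 :> R by ring.
split => //; apply: (le_trans first_bound).
rewrite ler_wpM2r ?sigma_ge0 // ler_pM2l // lef_pV2 ?posrE ?exprn_gt0 ?expR_gt0 //.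
apply: lerXn2r; rewrite ?nnegrE ?expR_ge0 // ler_expR.
have mu0 := grotzsch_mu_gt0 lI; have mul := grotzsch_mu_le_ln lI.
have -> : 4 * b / a = 4 / l by rewrite /l; field; rewrite !gt_eqF.
have ln0 := lt_le_trans mu0 mul.
apply: ler_wpM2l; first by rewrite sqr_ge0.
by rewrite lef_pV2 ?posrE ?ler_pM2l //; [exact: mulr_gt0 | exact: mulr_gt0].
Qed.
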